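(* Let $g:\mathbb{N}\to\mathbb{R}$ be an essentially bounded real arithmetic function and let $H=H(N)$ be a positive integer with $H\asymp N^{\vartheta}$ for a fixed $\vartheta\in(1/3,1)$. Suppose there exists $G\in(0,1)$ such that $$J_{\mathrm{sgn},g}(N,h)\ll Nh^{2-G}\quad\text{for every integer } h\asymp N^{\theta}\ \text{with}\ \theta\in\Big(\frac{3\vartheta-1}{(1-G)\vartheta+G+1},\vartheta\Big].$$ Then $$J_{\mathrm{sgn},g\ast\mathbf{1}}(N,H)\ll NH^{2-G'}\quad\text{for every } G'\in\Big(0,\min\Big(\frac{3-\vartheta^{-1}}{1+2G^{-1}},\ \vartheta^{-1}-1\Big)\Big).$$
   Context: All asymptotic statements are as $N\to\infty$; $N$ and $H$ are positive integers with $H=o(N)$. For an integer $x$, ''$x\sim N$'' means $x\in(N,2N]$. $A\asymp B$ means $B\ll A\ll B$. An arithmetic function $f$ is essentially bounded if $f(n)\ll_\varepsilon n^{\varepsilon}$ for every $\varepsilon>0$. $\mathrm{sgn}(0)=0$, $\mathrm{sgn}(t)=|t|/t$ for $t\neq0$. For an arithmetic function $f$ the symmetry integral is $$J_{\mathrm{sgn},f}(N,H)=\sum_{x\sim N}\Big|\sum_{x-H\le n\le x+H}f(n)\,\mathrm{sgn}(n-x)\Big|^2.$$ $\mathbf{1}$ denotes the constant function $1$ and $g\ast\mathbf{1}(n)=\sum_{d\mid n}g(d)$ is Dirichlet convolution. *)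

(* Defs.v *)
From HB Require Import structures.
From mathcomp Require Import all_boot all_order all_algebra.
From mathcomp Require Import all_classical all_reals all_analysis.

Set Implicit Arguments.
Unset Strict Implicit.
Unset Printing Implicit Defensive.

Import Order.TTheory GRing.Theory Num.Theory.
Import numFieldNormedType.Exports.

Local Open Scope classical_set_scope.
Local Open Scope ring_scope.

(* Arithmetic functions are maps f : nat -> R of which only the values at
   positive integers are meaningful; the definitions below never use f 0,
   except essentially_bounded, which is insensitive to it. *)

(* The condition at large n is equivalent to the one for all n >= 1, since
   n `^ eps >= 1 there. *)
Definition essentially_bounded (R : realType) (f : nat -> R) : Prop :=
  forall eps : R, 0 < eps -> f =O_\oo (fun n : nat => n%:R `^ eps : R).

Definition dirichlet_conv (R : realType) (f g : nat -> R) (n : nat) : R :=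
  \sum_(d <- divisors n) f d * g (n %/ d)%N.

(* x - H <= n is written x <= n + H, nat subtraction being truncated. *)
Definition symmetry_sum (R : realType) (f : nat -> R) (x H : nat) : R :=
  \sum_(1 <= n < (x + H).+1 | (x <= n + H)%N) f n * Num.sg (n%:R - x%:R).

Definition symmetry_integral (R : realType) (f : nat -> R) (N H : nat) : R :=
  \sum_(N.+1 <= x < (2 * N).+1) `|symmetry_sum f x H| ^+ 2.

(* Main.v *)
(* Write the short sum of g * 1 as a sum over pairs (q, m) with n = q m, and
   cut it at q = Q, where Q is about N^(1 - d).

   Small q: this is a large sieve for the periodic functions
   chi_q(x) = #(multiples of q in (x, x+H]) - #(multiples in [x-H, x)).  By the
   Hermite identity for floors, the mean of chi_q1 chi_q2 over a period is at
   most 2 H gcd(q1, q2) / (q1 q2).  Averaging over a window of length Y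
   multiplies the sup norm of a mean-zero L-periodic function by at most L / Y,
   so that iterated averages over windows somewhat longer than Q^2 see only
   these means.  This part is N^eps (N + Q^2) H.

   Large q: then m is at most M, about N^d, and for fixed m the inner sum is a
   symmetry sum of g at (x / m, H / m), except for the few x within H of m Q,
   which cost H^3 N^eps.  Cauchy-Schwarz over m with weights 1 / m gives
   N^(1+eps) H^(2-G) M^G.

   The hypothesis on g is pointwise in theta, whereas the second part needs it
   uniformly for all lengths between N^t and H.  In terms of second differences
   of the partial sums of g, length r h is a combination of r^2 translates of
   length h; hence finitely many theta, at distance delta, give all lengths with
   a loss N^(4 delta), which is affordable because G' is not extremal. *)

Require Import Defs.
From HB Require Import structures.
From mathcomp Require Import all_boot all_order all_algebra.
From mathcomp Require Import all_classical all_reals all_analysis.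
From mathcomp Require Import zify ring lra.

Set Implicit Arguments.
Unset Strict Implicit.
Unset Printing Implicit Defensive.

Import Order.TTheory GRing.Theory Num.Theory.
Import numFieldNormedType.Exports.

Local Open Scope classical_set_scope.
Local Open Scope ring_scope.

(** * Floor counts and their correlations *)

Definition periodic (R : realType) (L : nat) (f : nat -> R) : Prop :=
  forall x, f (x + L)%N = f x.

Lemma periodic_muln (R : realType) (L k x : nat) (f : nat -> R) :
  periodic L f -> f (x + k * L)%N = f x.
Proof.
move=> pf; elim: k => [|k IH]; first by rewrite mul0n addn0.
by rewrite mulSnr addnA pf IH.
Qed.

Lemma periodic_modn (R : realType) (L x : nat) (f : nat -> R) :
  periodic L f -> f (x %% L)%N = f x.
Proof.
by move=> pf; rewrite [in RHS](divn_eq x L) addnC (periodic_muln _ _ pf).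
Qed.

Lemma sum_period_shift (R : realType) (L a : nat) (f : nat -> R) :
  periodic L f -> \sum_(i < L) f (a + i)%N = \sum_(i < L) f i.
Proof.
move=> pf; elim: a => [|a IH]; first by under eq_bigr do rewrite add0n.
rewrite -IH; case: L pf {IH} => [|L] pf; first by rewrite !big_ord0.
rewrite big_ord_recr [RHS]big_ord_recl /= addrC; congr (_ + _).
  by rewrite addSnnS pf addn0.
by apply: eq_bigr => i _; rewrite /bump /= addSnnS.
Qed.

Lemma sum_ord_mul (R : realType) (a b : nat) (f : nat -> R) :
  \sum_(i < a * b) f i = \sum_(j < b) \sum_(i < a) f (i + j * a)%N.
Proof.
elim: b => [|b IH]; first by rewrite muln0 !big_ord0.
rewrite [RHS]big_ord_recr /= -IH mulnSr big_split_ord /=; congr (_ + _).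
by apply: eq_bigr => i _; rewrite addnC [(a * b)%N]mulnC.
Qed.

Lemma sum_period_mul (R : realType) (L k : nat) (f : nat -> R) :
  periodic L f -> \sum_(i < L * k) f i = k%:R * \sum_(i < L) f i.
Proof.
move=> pf; rewrite sum_ord_mul mulr_natl.
rewrite -[in RHS](card_ord k) -sumr_const; apply: eq_bigr => j _.
by apply: eq_bigr => i _; rewrite (periodic_muln _ _ pf).
Qed.

(** Multiplication by [b] permutes the residues modulo [a]: by Gauss's lemma it is injective on
    them. *)
Lemma sum_period_coprime (R : realType) (a b : nat) (f : nat -> R) :
  coprime b a -> periodic a f -> \sum_(j < a) f (j * b)%N = \sum_(j < a) f j.
Proof.
case: a => [|a] cab pf; first by rewrite !big_ord0.
pose s (j : 'I_a.+1) : 'I_a.+1 := inord ((j * b) %% a.+1).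
have sE j : s j = ((j * b) %% a.+1)%N :> nat by rewrite inordK // ltn_mod.
rewrite [RHS](reindex_inj (h := s)) /=.
  by apply: eq_bigr => j _; rewrite sE (periodic_modn _ pf).
move=> i j /(congr1 val); rewrite /= !sE => /eqP.
wlog le_ij : i j / (i <= j)%N.
  move=> W; case/orP: (leq_total i j) => [/W //|/W W' E].
  by apply/esym/W'; rewrite eq_sym.
rewrite eq_sym eqn_mod_dvd ?leq_mul2r ?le_ij ?orbT // -mulnBl Gauss_dvdl; last first.
  by rewrite coprime_sym.
move=> dv; apply/val_inj/eqP; rewrite /= eqn_leq le_ij /= -subn_eq0.
apply: contraLR dv; rewrite -lt0n => dv.
by rewrite gtnNdvd // ltnS (leq_trans (leq_subr _ _)) // -ltnS.
Qed.

(** Induction on [n]: passing to [n.+1] drops the term [n %/ k] and brings in [(n + k) %/ k], which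
    is larger by one. *)
Lemma hermite (k n : nat) : (0 < k)%N -> (\sum_(j < k) ((n + j) %/ k) = n)%N.
Proof.
case: k => // k _; elim: n => [|n IH].
  by apply: big1 => j _; rewrite add0n divn_small.
rewrite big_ord_recr /= -[in RHS]IH [in RHS]big_ord_recl /=.
have -> : ((n.+1 + k) %/ k.+1 = (n + 0) %/ k.+1 + 1)%N.
  by rewrite addn0 addSnnS -{1}[k.+1]mul1n divnDMl.
rewrite addnA addn1 addnC; congr (_.+1).
by congr (_ + _)%N; apply: eq_bigr => j _; rewrite /bump /= addSnnS.
Qed.

(* Floor form of the multiples of q in (x, x + H] minus those in [x - H, x),
   at x = z + H + 1, so that truncated subtraction does not occur. *)
Definition sign_count (R : realType) (H q z : nat) : R :=
  ((z + (H + H).+1) %/ q)%:R - ((z + H.+1) %/ q)%:R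
  - (((z + H) %/ q)%:R - (z %/ q)%:R).

Lemma sign_count_periodic (R : realType) (H q : nat) :
  (0 < q)%N -> periodic q (sign_count R H q).
Proof.
move=> q0 z; rewrite /sign_count.
have E c : (((z + q) + c) %/ q = (z + c) %/ q + 1)%N.
  by rewrite -addnA [(q + c)%N]addnC addnA -{1}[q]mul1n divnDMl.
have := E 0%N; rewrite !addn0 => E0.
by rewrite !E E0 !natrD; ring.
Qed.

(** Each of the two differences of floors is [H %/ q] plus a carry bit, so only the difference of
    two bits survives. *)
Lemma sign_count_le1 (R : realType) (H q z : nat) :
  (0 < q)%N -> `|sign_count R H q z| <= 1.
Proof.
move=> q0; rewrite /sign_count.
have -> : (z + (H + H).+1 = (z + H.+1) + H)%N by lia.
rewrite (divnD (z + H.+1) H q0) (divnD z H q0) !natrD.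
have b01 (b : bool) : 0 <= (b%:R : R) <= 1 by case: b; rewrite ?lexx ?ler01.
have := b01 (q <= (z + H.+1) %% q + H %% q)%N.
have := b01 (q <= z %% q + H %% q)%N.
by move=> h1 h2; rewrite ler_norml; lra.
Qed.

(** Values are at most 1 in size, so a square is at most the absolute value, hence at most the sum
    of the two nonnegative floor differences. By [hermite] these sum to [H] each over a period. *)
Lemma sum_sign_count_sq (R : realType) (H q : nat) :
  (0 < q)%N -> \sum_(z < q) sign_count R H q z ^+ 2 <= 2 * H%:R.
Proof.
move=> q0.
have hm n : \sum_(z < q) ((z + n) %/ q)%:R = n%:R :> R.
  rewrite -natr_sum; congr (_%:R); rewrite -[RHS](hermite n q0).
  by apply: eq_bigr => j _; rewrite addnC.
have hm0 : \sum_(z < q) (z %/ q)%:R = 0%:R :> R.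
  by rewrite -(hm 0%N); apply: eq_bigr => j _; rewrite addn0.
apply: (@le_trans _ _ (\sum_(z < q)
   ((((z + (H + H).+1) %/ q)%:R - ((z + H.+1) %/ q)%:R)
  + (((z + H) %/ q)%:R - (z %/ q)%:R)))).
  apply: ler_sum => z _; rewrite -real_normK ?num_real //.
  apply: (@le_trans _ _ `|sign_count R H q z|).
    by rewrite expr2 ler_piMr // sign_count_le1.
  apply: le_trans (ler_normB _ _) _.
  by rewrite !ger0_norm // subr_ge0 ler_nat leq_div2r //; lia.
rewrite big_split /= !sumrB !hm hm0 -!natrB /=; [|lia..].
by rewrite -natrD -natrM ler_nat; lia.
Qed.

(** Summing over the residues modulo [d * k] that lie above [r] lowers the modulus to [d]: nested
    division turns each floor into [((r + c) %/ d + i) %/ k], to which [hermite] applies. *)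
Lemma sign_count_residue (R : realType) (H d k r : nat) :
  (0 < d)%N -> (0 < k)%N ->
  \sum_(i < k) sign_count R H (d * k) (r + d * i) = sign_count R H d r.
Proof.
move=> d0 k0; rewrite /sign_count.
have E c : \sum_(i < k) ((r + d * i + c) %/ (d * k))%:R = ((r + c) %/ d)%:R :> R.
  rewrite -natr_sum; congr (_%:R); rewrite -[RHS](hermite _ k0).
  apply: eq_bigr => i _; rewrite divnMA; congr (_ %/ k)%N.
  by rewrite addnAC mulnC divnDMl.
have E0 : \sum_(i < k) ((r + d * i) %/ (d * k))%:R = (r %/ d)%:R :> R.
  by rewrite -[in RHS](addn0 r) -E; apply: eq_bigr => i _; rewrite addn0.
by rewrite !sumrB !E E0.
Qed.

(** Write [z = r + j * q2]. For fixed [r], as [j] runs modulo [q1], the first factor visits every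
    residue modulo [q1] congruent to [r] modulo [d], each [d] times, and collapses to modulus [d] by
    [sign_count_residue]. The sum over [r] modulo [q2] then collapses in the same way. *)
Lemma sum_sign_count_mul (R : realType) (H q1 q2 : nat) :
  (0 < q1)%N -> (0 < q2)%N ->
  \sum_(z < q1 * q2) sign_count R H q1 z * sign_count R H q2 z =
  (gcdn q1 q2)%:R * \sum_(a < gcdn q1 q2) sign_count R H (gcdn q1 q2) a ^+ 2.
Proof.
move=> q10 q20; set d := gcdn q1 q2.
have d0 : (0 < d)%N by rewrite gcdn_gt0 q10.
pose a1 := (q1 %/ d)%N; pose a2 := (q2 %/ d)%N.
have E1 : q1 = (d * a1)%N by rewrite mulnC divnK // dvdn_gcdl.
have E2 : q2 = (d * a2)%N by rewrite mulnC divnK // dvdn_gcdr.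
have a10 : (0 < a1)%N by move: q10; rewrite E1 muln_gt0 => /andP[].
have a20 : (0 < a2)%N by move: q20; rewrite E2 muln_gt0 => /andP[].
have cop : coprime a2 a1.
  by rewrite /coprime -(eqn_pmul2l d0) muln_gcdr -E1 -E2 muln1 gcdnC.
have P1 := sign_count_periodic R H q10; have P2 := sign_count_periodic R H q20.
rewrite mulnC (sum_ord_mul q2 q1 (fun z => sign_count R H q1 z * sign_count R H q2 z)).
rewrite exchange_big /=.
transitivity (\sum_(r < q2) sign_count R H q2 r * (d%:R * sign_count R H d r)).
  apply: eq_bigr => r _.
  under eq_bigr => j _ do rewrite (periodic_muln _ _ P2) mulrC.
  rewrite -mulr_sumr; congr (_ * _).
  pose psi i := sign_count R H q1 (r + d * i)%N.
  have ppsi : periodic a1 psi by move=> i; rewrite /psi mulnDr -E1 addnA P1.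
  rewrite -(sign_count_residue R H r d0 a10) -E1 -(sum_period_coprime cop ppsi).
  have pp : periodic a1 (fun j => psi (j * a2)%N).
    by move=> i; rewrite mulnDl [(a1 * a2)%N]mulnC (periodic_muln _ _ ppsi).
  rewrite -(sum_period_mul d pp) [(a1 * d)%N]mulnC -E1.
  by apply: eq_bigr => j _; rewrite /psi mulnCA -E2.
have -> : \sum_(r < q2) sign_count R H q2 r * (d%:R * sign_count R H d r) =
  \sum_(j < a2) \sum_(i < d) sign_count R H q2 (i + j * d) *
     (d%:R * sign_count R H d (i + j * d)).
  by rewrite -(sum_ord_mul d a2 (fun r => sign_count R H q2 r * (d%:R * sign_count R H d r))) -E2.
rewrite exchange_big mulr_sumr; apply: eq_bigr => a _.
rewrite expr2 -{2}(sign_count_residue R H a d0 a20) mulrCA !mulr_sumr.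
have Pd := sign_count_periodic R H d0.
rewrite -mulr_sumr mulr_sumr; apply: eq_bigr => i _.
by rewrite -E2 (periodic_muln _ _ Pd) [(d * i)%N]mulnC; ring.
Qed.

(** * A large sieve by iterated averaging *)

Definition avg (R : realType) (Y : nat) (f : nat -> R) (x : nat) : R :=
  Y%:R^-1 * \sum_(y < Y) f (x + y)%N.

Lemma avg_periodic (R : realType) (L Y : nat) (f : nat -> R) :
  periodic L f -> periodic L (avg Y f).
Proof.
by move=> pf x; rewrite /avg; congr (_ * _); apply: eq_bigr => i _; rewrite addnAC pf.
Qed.

Lemma avg_sum0 (R : realType) (L Y : nat) (f : nat -> R) :
  periodic L f -> \sum_(i < L) f i = 0 -> \sum_(i < L) avg Y f i = 0.
Proof.
move=> pf s0; rewrite -mulr_sumr exchange_big /= big1 ?mulr0 // => y _.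
by rewrite -[RHS]s0 -(sum_period_shift y pf); apply: eq_bigr => i _; rewrite addnC.
Qed.

(** The full periods inside the window cancel, and fewer than [L] terms remain. *)
Lemma avg_contract (R : realType) (L Y : nat) (f : nat -> R) (C : R) :
  (0 < L)%N -> (0 < Y)%N -> periodic L f -> \sum_(i < L) f i = 0 ->
  (forall x, `|f x| <= C) -> forall x, `|avg Y f x| <= (L%:R / Y%:R) * C.
Proof.
move=> L0 Y0 pf s0 fC x; rewrite /avg normrM normfV normr_nat mulrC mulrAC.
rewrite ler_wpM2r ?invr_ge0 //.
have C0 : 0 <= C by apply: le_trans (fC 0%N); rewrite normr_ge0.
have pf' : periodic L (fun y => f (x + y)%N) by move=> y; rewrite addnA pf.
have -> : \sum_(y < Y) f (x + y)%N = \sum_(y < L * (Y %/ L) + Y %% L) f (x + y)%N.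
  by rewrite [(L * _)%N]mulnC -divn_eq.
rewrite big_split_ord /= (sum_period_mul (Y %/ L) pf') (sum_period_shift x pf) s0.
rewrite mulr0 add0r; apply: le_trans (ler_norm_sum _ _ _) _.
apply: (@le_trans _ _ (\sum_(i < Y %% L) C)); first exact: ler_sum.
by rewrite sumr_const card_ord -[C *+ _]mulr_natl ler_wpM2r // ler_nat ltnW // ltn_pmod.
Qed.

Lemma iter_avg_contract (R : realType) (L Y k : nat) (f : nat -> R) (C : R) :
  (0 < L)%N -> (0 < Y)%N -> periodic L f -> \sum_(i < L) f i = 0 ->
  (forall x, `|f x| <= C) ->
  forall x, `|iter k (avg Y) f x| <= (L%:R / Y%:R) ^+ k * C.
Proof.
move=> L0 Y0 pf s0 fC.
suff [] : [/\ periodic L (iter k (avg Y) f), \sum_(i < L) iter k (avg Y) f i = 0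
  & forall x, `|iter k (avg Y) f x| <= (L%:R / Y%:R) ^+ k * C] by [].
elim: k => [|k [IH1 IH2 IH3]] /=; first by split => // x; rewrite mul1r.
split; [exact: avg_periodic|exact: avg_sum0|move=> x].
by rewrite exprS -mulrA; exact: avg_contract.
Qed.

Lemma iter_avg_affine (R : realType) (Y k : nat) (I : Type) (s : seq I)
    (c : I -> R) (f : I -> nat -> R) (x : nat) :
  iter k (avg Y) (fun z => \sum_(i <- s) c i * f i z) x =
  \sum_(i <- s) c i * iter k (avg Y) (f i) x.
Proof.
elim: k x => //= k IH x; rewrite {1}/avg.
rewrite (eq_bigr _ (fun (y : 'I_Y) _ => IH (x + y)%N)).
rewrite exchange_big mulr_sumr; apply: eq_bigr => i _.
by rewrite -mulr_sumr mulrCA.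
Qed.

Lemma iter_avgB_cst (R : realType) (Y k : nat) (f : nat -> R) (c : R) (x : nat) :
  (0 < Y)%N ->
  iter k (avg Y) (fun z => f z - c) x = iter k (avg Y) f x - c.
Proof.
move=> Y0; elim: k x => //= k IH x; rewrite {1}/avg.
under eq_bigr do rewrite IH.
rewrite sumrB sumr_const card_ord mulrBr -/(avg _ _ _); congr (_ - _).
by rewrite -[c *+ _]mulr_natl mulKf // pnatr_eq0 -lt0n.
Qed.

Lemma avg_ge0 (R : realType) (Y : nat) (f : nat -> R) :
  (forall x, 0 <= f x) -> forall x, 0 <= avg Y f x.
Proof. by move=> f0 x; rewrite mulr_ge0 ?invr_ge0 // sumr_ge0. Qed.

(** For [i < Z] the window of length [2 * Z] at [a + i] contains the whole block of length [Z]
    starting at [a + Z], so each average is at least the block sum over [2 * Z]. *)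
Lemma sum_avg_ge (R : realType) (Z a : nat) (f : nat -> R) :
  (0 < Z)%N -> (forall x, 0 <= f x) ->
  \sum_(i < Z) f (a + Z + i)%N <= 2 * \sum_(i < Z) avg (2 * Z) f (a + i)%N.
Proof.
move=> Z0 f0; set S := \sum_(i < Z) f (a + Z + i)%N.
have Zn0 : Z%:R != 0 :> R by rewrite pnatr_eq0 -lt0n.
suff H i : (i < Z)%N -> (2 * Z)%:R^-1 * S <= avg (2 * Z) f (a + i)%N.
  apply: (@le_trans _ _ (2 * \sum_(i < Z) ((2 * Z)%:R^-1 * S))); last first.
    by rewrite ler_wpM2l // ler_sum // => i _; apply: H.
  have -> : \sum_(i < Z) (2 * Z)%:R^-1 * S = Z%:R * ((2 * Z)%:R^-1 * S).
    by rewrite sumr_const card_ord -[_ *+ Z]mulr_natl.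
  by rewrite natrM le_eqVlt; apply/orP; left; apply/eqP; field.
move=> iZ; rewrite ler_wpM2l ?invr_ge0 //.
have -> : (2 * Z = (Z - i) + (Z + i))%N by lia.
rewrite big_split_ord /= big_split_ord /= addrA addrC addrA.
have -> : S = \sum_(j < Z) f (a + i + (Z - i + j))%N.
  by apply: eq_bigr => j _; congr f; lia.
by rewrite lerDr addr_ge0 // sumr_ge0.
Qed.

(** Each use of [sum_avg_ge] moves the block back by [Z]; after [k] of them it starts at [a], where
    one last average covers it. A sum over a block is thus controlled by a single value of an
    iterated average. *)
Lemma sum_iter_avg_ge (R : realType) (Z a k : nat) (f : nat -> R) :
  (0 < Z)%N -> (forall x, 0 <= f x) ->
  \sum_(i < Z) f (a + k * Z + i)%N <=
  2 ^+ k.+1 * Z%:R * iter k.+1 (avg (2 * Z)) f a.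
Proof.
move=> Z0 f0.
have g0 j x : 0 <= iter j (avg (2 * Z)) f x.
  by elim: j x => // j IH x; exact: avg_ge0.
(* The alternative [k < j] lets the induction on [j] run freely; beyond [k] the subtraction [k - j]
   would be truncated. *)
have H j : \sum_(i < Z) f (a + k * Z + i)%N <=
    2 ^+ j * \sum_(i < Z) iter j (avg (2 * Z)) f (a + (k - j) * Z + i)%N \/ (k < j)%N.
  elim: j => [|j [IH|lt]]; [|have [lt|lt] := ltnP k j.+1|].
  - by left; rewrite mul1r subn0.
  - by right.
  - left; apply: le_trans IH _; rewrite exprSr -mulrA ler_wpM2l ?exprn_ge0 //.
    have -> : (a + (k - j) * Z = a + (k - j.+1) * Z + Z)%N.
      by rewrite -addnA -mulSnr subnSK.
    exact: sum_avg_ge.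
  - by right; rewrite ltnW.
case: (H k) => [|]; last by rewrite ltnn.
move=> /le_trans; apply.
rewrite subnn mul0n addn0 exprS -!mulrA [leRHS]mulrCA ler_wpM2l ?exprn_ge0 //=.
rewrite {2}/avg natrM invfM !mulrA [2 * _]mulrC -!mulrA [2 * _]mulrCA.
rewrite [Z%:R * _]mulrC !mulrA.
have Zn0 : Z%:R != 0 :> R by rewrite pnatr_eq0 -lt0n.
rewrite mulVf // mul1r.
rewrite mulrAC mulVf // mul1r mul2n -addnn big_split_ord /= lerDl.
by apply: sumr_ge0 => i _; have := g0 k (a + (Z + i))%N; rewrite mul2n -addnn.
Qed.

(** * Gcd sums and the large sieve inequality *)

Definition harm (R : realType) (Q : nat) : R := \sum_(i < Q) i.+1%:R^-1.

(** With [d] the gcd, [i = d * k] and [j = d * l], the term becomes [1 / (d * k * l)]. A triple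
    [(d, k, l)] determines its pair, so by positivity the sum is at most that over all triples, a
    product of three harmonic sums. *)
Lemma sum_gcd (R : realType) (Q : nat) :
  \sum_(i < Q) \sum_(j < Q) (gcdn i.+1 j.+1)%:R / (i.+1%:R * j.+1%:R) <=
  harm R Q ^+ 3.
Proof.
pose w (d k l : 'I_Q) : R := d.+1%:R^-1 * (k.+1%:R^-1 * l.+1%:R^-1).
have w0 d k l : 0 <= w d k l by rewrite !mulr_ge0 ?invr_ge0.
pose b (i j d k l : 'I_Q) : bool :=
  (i.+1 == d.+1 * k.+1)%N && (j.+1 == d.+1 * l.+1)%N.
apply: (@le_trans _ _ (\sum_(i < Q) \sum_(j < Q) \sum_(d < Q) \sum_(k < Q)
   \sum_(l < Q) (b i j d k l)%:R * w d k l)).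
  apply: ler_sum => i _; apply: ler_sum => j _.
  have g0 : (0 < gcdn i.+1 j.+1)%N by rewrite gcdn_gt0.
  have [k Ek] : exists k, i.+1 = (gcdn i.+1 j.+1 * k)%N.
    by have /dvdnP[k Ek] := dvdn_gcdl i.+1 j.+1; exists k; rewrite mulnC.
  have [l El] : exists l, j.+1 = (gcdn i.+1 j.+1 * l)%N.
    by have /dvdnP[l El] := dvdn_gcdr i.+1 j.+1; exists l; rewrite mulnC.
  move: g0 Ek El; move: (gcdn _ _) => d d0 Ek El.
  have k0 : (0 < k)%N by case: k Ek => // ; rewrite muln0.
  have l0 : (0 < l)%N by case: l El => // ; rewrite muln0.
  case: d d0 Ek El => // d _ Ek El.
  case: k k0 Ek => // k _ Ek; case: l l0 El => // l _ El.
  have dQ : (d < Q)%N.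
    by apply: leq_trans (ltn_ord i); rewrite Ek leq_pmulr.
  have kQ : (k < Q)%N.
    by apply: leq_trans (ltn_ord i); rewrite Ek leq_pmull.
  have lQ : (l < Q)%N.
    by apply: leq_trans (ltn_ord j); rewrite El leq_pmull.
  rewrite (bigD1 (Ordinal dQ)) //= (bigD1 (Ordinal kQ)) //= (bigD1 (Ordinal lQ)) //=.
  rewrite {1}/b /= -Ek -El !eqxx /= mul1r -!addrA.
  apply: (@le_trans _ _ (w (Ordinal dQ) (Ordinal kQ) (Ordinal lQ))).
    rewrite Ek El /w /= !natrM le_eqVlt; apply/orP; left; apply/eqP.
    have nz n : n.+1%:R != 0 :> R by rewrite pnatr_eq0.
    move: (nz d) (nz k) (nz l).
    move: (d.+1%:R : R) (k.+1%:R : R) (l.+1%:R : R) => x y z xn yn zn.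
    by field; rewrite ?xn ?yn ?zn.
  rewrite lerDl !addr_ge0 // ?sumr_ge0 // => *; rewrite ?sumr_ge0 // => *;
  by rewrite ?sumr_ge0 // => *; rewrite mulr_ge0.
under eq_bigr => i _.
  rewrite exchange_big /=; under eq_bigr => d _.
    rewrite exchange_big /=; under eq_bigr => k _ do rewrite exchange_big /=.
    over.
  over.
rewrite exchange_big /=.
have -> : harm R Q ^+ 3 = \sum_(d < Q) \sum_(k < Q) \sum_(l < Q) w d k l.
  rewrite exprS expr2 /harm mulr_suml; apply: eq_bigr => d _.
  rewrite mulr_suml mulr_sumr; apply: eq_bigr => k _.
  by rewrite !mulr_sumr; apply: eq_bigr.
apply: ler_sum => d _; rewrite exchange_big; apply: ler_sum => k _.
rewrite exchange_big; apply: ler_sum => l _ /=.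
under eq_bigr do rewrite -mulr_suml.
rewrite -mulr_suml ler_piMl //.
have [/existsP[[i j] /= bij]|] := boolP [exists p : 'I_Q * 'I_Q, b p.1 p.2 d k l]; last first.
  rewrite negb_exists => /forallP nb.
  rewrite big1 // => i _; rewrite big1 // => j _.
  by have := nb (i, j) => /= /negbTE ->.
rewrite (bigD1 i) //= (bigD1 j) //= bij big1 => [|j' jj']; last first.
  case: (boolP (b i j' d k l)) => // /andP[_ /eqP e]; case/eqP: jj'.
  by apply/val_inj; move/andP: bij => [_ /eqP e']; apply: succn_inj; rewrite e e'.
rewrite addr0 big1 ?addr0 // => i' ii'; rewrite big1 // => j' _.
case: (boolP (b i' j' d k l)) => // /andP[/eqP e _]; case/eqP: ii'.
by apply/val_inj; move/andP: bij => [/eqP e' _]; apply: succn_inj; rewrite e e'.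
Qed.

(** The product is split into its mean [c] over the period [q1 * q2], which averaging preserves and
    which gives the gcd term, and a mean-zero part of size at most 2, which [k] averages
    contract. *)
Lemma sign_count_corr (R : realType) (H q1 q2 Y k a : nat) :
  (0 < q1)%N -> (0 < q2)%N -> (0 < Y)%N ->
  `|iter k (avg Y) (fun z => sign_count R H q1 z * sign_count R H q2 z) a| <=
  2 * H%:R * ((gcdn q1 q2)%:R / (q1%:R * q2%:R))
  + 2 * ((q1 * q2)%:R / Y%:R) ^+ k.
Proof.
move=> q10 q20 Y0; set f := fun z => _; set L := (q1 * q2)%N.
have L0 : (0 < L)%N by rewrite muln_gt0 q10.
have Ln0 : L%:R != 0 :> R by rewrite pnatr_eq0 -lt0n.
have pf : periodic L f.
  move=> z; rewrite /f /L {1}mulnC (periodic_muln _ _ (sign_count_periodic R H q10)).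
  by rewrite (periodic_muln _ _ (sign_count_periodic R H q20)).
have f1 z : `|f z| <= 1.
  by rewrite normrM mulr_ile1 // sign_count_le1.
pose c : R := L%:R^-1 * \sum_(z < L) f z.
have c1 : `|c| <= 1.
  rewrite normrM normfV normr_nat mulrC ler_pdivrMr ?ltr0n // mul1r.
  apply: le_trans (ler_norm_sum _ _ _) _.
  apply: (@le_trans _ _ (\sum_(z < L) 1)); first exact: ler_sum.
  by rewrite sumr_const card_ord.
have cb : `|c| <= 2 * H%:R * ((gcdn q1 q2)%:R / (q1%:R * q2%:R)).
  rewrite /c /f sum_sign_count_mul // !normrM normfV !normr_nat.
  rewrite ger0_norm ?sumr_ge0 // => [|i _]; last exact: sqr_ge0.
  rewrite /L natrM mulrCA [leRHS]mulrC -mulrA ler_wpM2l //.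
  rewrite ler_wpM2l ?invr_ge0 ?mulr_ge0 //.
  by apply: sum_sign_count_sq; rewrite gcdn_gt0 q10.
have := @iter_avg_contract R L Y k (fun z => f z - c) 2 L0 Y0 _ _ _ a.
rewrite iter_avgB_cst // => E.
rewrite -[X in `|X|](subrK c); apply: le_trans (ler_normD _ _) _.
rewrite addrC lerD // [leRHS]mulrC; apply: E.
- by move=> z; rewrite pf.
- rewrite sumrB sumr_const card_ord -[c *+ _]mulr_natl /c mulrA mulfV //.
  by rewrite mul1r subrr.
- by move=> z; apply: le_trans (ler_normB _ _) _; rewrite -[2]/(1 + 1) lerD.
Qed.

(** The block sum of the square is dominated by one value of an iterated average; expanding the
    square there leaves only correlations of pairs, and [sum_gcd] adds up their means. The number of
    averages stays free: once [Z] exceeds [Q ^ 2] by a small power, a fixed [k] makes the error term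
    negligible. *)
Lemma large_sieve (R : realType) (g : nat -> R) (B : R) (H Q Z k a : nat) :
  (0 < Z)%N -> (forall q, (0 < q <= Q)%N -> `|g q| <= B) ->
  \sum_(i < Z) (\sum_(q < Q) g q.+1 * sign_count R H q.+1 (a + i)) ^+ 2 <=
  2 ^+ k.+1 * Z%:R * (B ^+ 2 * (2 * H%:R * harm R Q ^+ 3
     + 2 * Q%:R ^+ 2 * (Q%:R ^+ 2 / (2 * Z)%:R) ^+ k.+1)).
Proof.
move=> Z0 gB; pose F z := \sum_(q < Q) g q.+1 * sign_count R H q.+1 z.
have pF : periodic Q`! F.
  move=> z; apply: eq_bigr => q _; congr (_ * _).
  have /dvdnP[m ->] : (q.+1 %| Q`!)%N by rewrite dvdn_fact //= ltn_ord.
  by rewrite periodic_muln //; exact: sign_count_periodic.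
(* The averages need room of length [k * Z] before the block, which truncated subtraction from [a]
   might not provide. Since [F] has period Q factorial, the block may first be moved forward by
   [k * Z] such periods. *)
pose a' := (a + k * Z * (Q`!).-1)%N.
have a'E i : (a' + k * Z + i = a + i + k * Z * Q`!)%N.
  by rewrite /a' -[in RHS](prednK (fact_gt0 Q)) mulnS; lia.
have -> : \sum_(i < Z) (\sum_(q < Q) g q.+1 * sign_count R H q.+1 (a + i)) ^+ 2 =
   \sum_(i < Z) (fun z => F z ^+ 2) (a' + k * Z + i)%N.
  by apply: eq_bigr => i _; rewrite /= a'E (periodic_muln _ _ pF).
apply: le_trans (@sum_iter_avg_ge R Z a' k (fun z => F z ^+ 2) Z0 _) _ => [x|].
  exact: sqr_ge0.
rewrite ler_wpM2l ?mulr_ge0 ?exprn_ge0 //.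
have -> : (fun z => F z ^+ 2) = (fun z => \sum_(p : 'I_Q * 'I_Q)
   (g p.1.+1 * g p.2.+1) * (sign_count R H p.1.+1 z * sign_count R H p.2.+1 z)).
  apply/funext => z; rewrite expr2 /F big_distrlr /= pair_big /=.
  by apply: eq_bigr => p _; rewrite mulrACA.
rewrite iter_avg_affine.
apply: (@le_trans _ _ (\sum_(p : 'I_Q * 'I_Q) B ^+ 2 *
   (2 * H%:R * ((gcdn p.1.+1 p.2.+1)%:R / (p.1.+1%:R * p.2.+1%:R))
     + 2 * (Q%:R ^+ 2 / (2 * Z)%:R) ^+ k.+1))).
  apply: ler_sum => -[i j] _ /=; apply: le_trans (ler_norm _) _.
  rewrite normrM ler_pM //.
    by rewrite normrM expr2 ler_pM // gB //= ltn_ord.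
  apply: le_trans (@sign_count_corr R H i.+1 j.+1 (2 * Z) k.+1 a' _ _ _) _ => //.
    by rewrite muln_gt0.
  rewrite lerD2l ler_wpM2l // lerXn2r ?nnegrE ?mulr_ge0 ?invr_ge0 ?exprn_ge0 //.
  rewrite ler_wpM2r ?invr_ge0 // expr2 -natrM ler_nat leq_mul //.
rewrite -mulr_sumr ler_wpM2l ?sqr_ge0 // big_split /= -mulr_sumr lerD //.
  rewrite ler_wpM2l ?mulr_ge0 //; apply: le_trans (sum_gcd R Q).
  by rewrite pair_big.
rewrite sumr_const card_prod card_ord -[_ *+ _]mulr_natl natrM.
by rewrite le_eqVlt; apply/orP; left; apply/eqP; ring.
Qed.

(** * Reduction to partial sums of g *)

(** The lower limit encodes the restriction to divisors beyond the cut [Q]; [Q = 0] gives the full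
    partial sum. *)
Definition psum (R : realType) (g : nat -> R) (Q y : nat) : R :=
  \sum_(Q.+1 <= n < y.+1) g n.

Lemma psum_small (R : realType) (g : nat -> R) (Q y : nat) :
  (y <= Q)%N -> psum g Q y = 0.
Proof. by move=> yQ; rewrite /psum big_geq. Qed.

Lemma psumB (R : realType) (g : nat -> R) (Q u v : nat) :
  (Q <= u)%N -> (u <= v)%N -> psum g Q v - psum g Q u = psum g u v.
Proof.
by move=> Qu uv; rewrite /psum (@big_cat_nat _ _ _ u.+1) //= addrAC subrr add0r.
Qed.

Lemma psum_widen (R : realType) (g : nat -> R) (Q X y : nat) : (y <= X)%N ->
  psum g Q y = \sum_(Q.+1 <= n < X.+1) g n * (n <= y)%:R.
Proof.
move=> yX; rewrite /psum (big_nat_widen _ _ X.+1) // big_mkcond.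
by apply: eq_bigr => n _; rewrite /= ltnS; case: (n <= y)%N; rewrite ?mulr1 ?mulr0.
Qed.

Lemma psum_norm (R : realType) (g : nat -> R) (B : R) (Q y : nat) :
  0 <= B -> (forall n, (0 < n <= y)%N -> `|g n| <= B) ->
  `|psum g Q y| <= (y - Q)%:R * B.
Proof.
move=> B0 gB; apply: le_trans (ler_norm_sum _ _ _) _.
apply: (@le_trans _ _ (\sum_(Q.+1 <= n < y.+1) B)).
  rewrite big_nat [leRHS]big_nat; apply: ler_sum => n /andP[n1 n2].
  by apply: gB; rewrite (leq_ltn_trans _ n1).
by rewrite big_const_nat iter_addr addr0 subSS mulr_natl.
Qed.

Lemma psum_lip (R : realType) (g : nat -> R) (B : R) (Q u v : nat) :
  0 <= B -> (forall n, (0 < n <= v)%N -> `|g n| <= B) -> (u <= v)%N ->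
  `|psum g Q v - psum g Q u| <= (v - u)%:R * B.
Proof.
move=> B0 gB uv; have [Qu|uQ] := leqP Q u.
  by rewrite psumB //; exact: psum_norm.
rewrite (psum_small _ (ltnW uQ)) subr0; apply: le_trans (psum_norm _ B0 gB) _.
by rewrite ler_wpM2r // ler_nat leq_sub2l // ltnW.
Qed.

(** Up to boundary terms this is [symmetry_sum g y h]. Unlike the latter it decomposes exactly when
    [h] is multiplied by an integer. *)
Definition second_diff (R : realType) (g : nat -> R) (y h : nat) : R :=
  psum g 0 (y + h) - 2 * psum g 0 y + psum g 0 (y - h).

(** The part of the short sum with cofactor [m] and divisor beyond [Q]. The arguments [x.-1] and
    [x - H.+1] arise because the point [x] has sign zero while the end point [x - H] is counted. *)
Definition multiple_sum (R : realType) (g : nat -> R) (Q m x H : nat) : R :=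
  psum g Q ((x + H) %/ m) - psum g Q (x %/ m)
  - (psum g Q (x.-1 %/ m) - psum g Q ((x - H.+1) %/ m)).

Lemma multiple_sumE (R : realType) (g : nat -> R) (Q m x H X : nat) :
  (0 < m)%N -> (H < x)%N -> ((x + H) %/ m <= X)%N ->
  \sum_(Q.+1 <= q < X.+1 | (x <= q * m + H)%N && (q * m <= x + H)%N)
     g q * Num.sg ((q * m)%:R - x%:R) = multiple_sum g Q m x H.
Proof.
move=> m0 Hx uX.
have le_u (z : nat) : (z <= x + H)%N -> (z %/ m <= X)%N.
  by move=> zx; apply: leq_trans uX; exact: leq_div2r.
rewrite /multiple_sum !(psum_widen g Q (le_u _ _)); [|lia..].
rewrite -!sumrB big_mkcond; apply: eq_bigr => q _ /=.
rewrite !leq_divRL //; set n := (q * m)%N; rewrite -!mulrBr.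
have sgE : Num.sg (n%:R - x%:R : R) = (x < n)%N%:R - (n < x)%N%:R.
  case: (ltngtP x n) => [lt|lt|->].
  - by rewrite gtr0_sg ?subr_gt0 ?ltr_nat // subr0.
  - by rewrite ltr0_sg ?subr_lt0 ?ltr_nat // sub0r.
  - by rewrite !subrr sgr0.
rewrite sgE.
have -> : (n <= x.-1)%N = (n < x)%N by lia.
have -> : (n <= x - H.+1)%N = ~~ (x <= n + H)%N by lia.
have -> : (n <= x)%N = ~~ (x < n)%N by lia.
case: (ltngtP x n) => [lt|lt|eq] /=.
- have -> : (x <= n + H)%N by lia.
  by case: (n <= x + H)%N; rewrite /= !(subr0, mulr1, mulr0).
- have -> : (n <= x + H)%N by lia.
  by case: (x <= n + H)%N; rewrite /= !(subr0, subrr, sub0r, mulr1, mulr0).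
- have -> : (n <= x + H)%N by lia.
  have -> : (x <= n + H)%N by lia.
  by rewrite /= !(subrr, subr0, mulr0).
Qed.

Lemma symmetry_sumE (R : realType) (g : nat -> R) (x H : nat) :
  (H < x)%N -> symmetry_sum g x H = multiple_sum g 0 1 x H.
Proof.
move=> Hx; rewrite -(@multiple_sumE _ g 0 1 x H (x + H)) //; last by rewrite divn1.
rewrite /symmetry_sum big_nat_cond [RHS]big_nat_cond; apply: eq_big => [n|n _].
  by rewrite muln1; lia.
by rewrite muln1.
Qed.

(** For small divisors the roles are exchanged: the divisor [q] occupies the modulus slot, and the
    constant function counts the cofactors. *)
Lemma multiple_sum_one (R : realType) (x H q : nat) : (H < x)%N ->
  multiple_sum (fun=> 1) 0 q x H = sign_count R H q (x - H.+1).
Proof.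
move=> Hx; have P1 y : psum (fun=> 1 : R) 0 y = y%:R.
  by rewrite /psum big_const_nat iter_addr addr0 subn1.
rewrite /multiple_sum /sign_count !P1.
have -> : (x - H.+1 + (H + H).+1 = x + H)%N by lia.
have -> : (x - H.+1 + H.+1 = x)%N by lia.
by have -> : (x - H.+1 + H = x.-1)%N by lia.
Qed.

(** * Splitting the convolution at the cut *)

Lemma dirichlet_conv_oneE (R : realType) (g : nat -> R) (n X : nat) :
  (0 < n <= X)%N -> dirichlet_conv g (fun=> 1) n =
  \sum_(1 <= q < X.+1) \sum_(1 <= m < X.+1) (q * m == n)%N%:R * g q.
Proof.
move=> /andP[n0 nX]; rewrite /dirichlet_conv.
transitivity (\sum_(1 <= q < X.+1 | (q %| n)%N) g q).
  rewrite -[RHS]big_filter (eq_bigr g) => [|d _]; last by rewrite mulr1.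
  apply: perm_big; apply: uniq_perm.
  - exact: divisors_uniq.
  - by rewrite filter_uniq // iota_uniq.
  - move=> q; rewrite mem_filter -dvdn_divisors // mem_index_iota.
    case dv : (q %| n)%N => //=.
    by rewrite (dvdn_gt0 n0 dv) ltnS (leq_trans (dvdn_leq n0 dv) nX).
rewrite big_mkcond big_nat [RHS]big_nat; apply: eq_bigr => q /andP[q0 _].
rewrite -mulr_suml.
case: ifP => [/dvdnP[k nE]|ndv]; last first.
  rewrite big1 ?mul0r // => m _; case: eqP => // E.
  by move: ndv; rewrite -E dvdn_mulr.
have k0 : (0 < k)%N by move: n0; rewrite nE muln_gt0 => /andP[].
have kX : (k <= X)%N by apply: leq_trans nX; rewrite nE leq_pmulr.
rewrite (bigD1_seq k) ?iota_uniq ?mem_index_iota ?k0 //=.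
rewrite mulnC -nE eqxx big1 ?addr0 ?mul1r // => m mk.
case: eqP => // E; case/eqP: mk; apply/eqP.
by rewrite -(eqn_pmul2l q0) E nE mulnC.
Qed.

(** For [q <= Q] the sum over all cofactors is a [sign_count]. For [q > Q] the order of summation is
    exchanged, and [q * m <= x + H < Q.+1 * M.+1] forces [m <= M]. *)
Lemma symmetry_sum_conv (R : realType) (g : nat -> R) (x H Q M : nat) :
  (H < x)%N -> (Q <= x + H)%N -> (M <= x + H)%N ->
  (x + H < Q.+1 * M.+1)%N ->
  symmetry_sum (dirichlet_conv g (fun=> 1)) x H =
  \sum_(q < Q) g q.+1 * sign_count R H q.+1 (x - H.+1)
  + \sum_(m < M) multiple_sum g Q m.+1 x H.
Proof.
move=> Hx QX MX QM; set X := (x + H)%N in QX MX QM *.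
pose c (n : nat) : bool := (x <= n + H)%N && (n <= X)%N.
pose t (q m : nat) : R := if c (q * m)%N then Num.sg ((q * m)%:R - x%:R) else 0.
have E1 : symmetry_sum (dirichlet_conv g (fun=> 1)) x H =
    \sum_(1 <= q < X.+1) \sum_(1 <= m < X.+1) g q * t q m.
  rewrite /symmetry_sum big_mkcond /=.
  transitivity (\sum_(1 <= n < X.+1) \sum_(1 <= q < X.+1) \sum_(1 <= m < X.+1)
     (q * m == n)%N%:R * (g q * t q m)).
    rewrite big_nat [RHS]big_nat; apply: eq_bigr => n /andP[n0 nX].
    rewrite (@dirichlet_conv_oneE _ _ _ X) ?n0 //.
    rewrite -[if _ then _ else _]/(if (x <= n + H)%N then _ else 0).
    have -> (a : R) : (if (x <= n + H)%N then a * Num.sg (n%:R - x%:R) else 0) =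
        a * (if c n then Num.sg (n%:R - x%:R) else 0).
      have nX' : (n <= X)%N by rewrite -ltnS.
      by rewrite /c nX' andbT; case: ifP; rewrite ?mulr0.
    rewrite mulr_suml; apply: eq_bigr => q _; rewrite mulr_suml.
    apply: eq_bigr => m _; rewrite -mulrA /t.
    by case: eqP => [->|_]; rewrite ?mul1r ?mul0r.
  rewrite exchange_big big_nat [RHS]big_nat; apply: eq_bigr => q /andP[q0 _] /=.
  rewrite exchange_big big_nat [RHS]big_nat; apply: eq_bigr => m /andP[m0 _] /=.
  rewrite -mulr_suml; have [cqm|ncqm] := boolP (c (q * m)%N); last first.
    by rewrite /t (negbTE ncqm) !mulr0.
  rewrite (bigD1_seq (q * m)%N) ?iota_uniq //=; last first.
    by rewrite mem_index_iota muln_gt0 q0 m0 ltnS; case/andP: cqm.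
  by rewrite eqxx big1 ?addr0 ?mul1r // => n /negbTE nqm; rewrite eq_sym nqm.
rewrite E1 (@big_cat_nat _ _ _ Q.+1) //=; congr (_ + _).
  rewrite big_add1 /= big_mkord; apply: eq_bigr => q _.
  rewrite -mulr_sumr -multiple_sum_one // -(@multiple_sumE _ _ _ _ _ _ X) //; last first.
    exact: leq_div.
  rewrite [in RHS]big_mkcond; congr (_ * _); apply: eq_bigr => m _.
  by rewrite /t /c [(q.+1 * m)%N]mulnC mul1r.
rewrite exchange_big /=.
have E2 m : (0 < m)%N ->
    \sum_(Q.+1 <= q < X.+1) g q * t q m = multiple_sum g Q m x H.
  move=> m0; rewrite -(@multiple_sumE _ _ _ _ _ _ X) //; last exact: leq_div.
  rewrite [in RHS]big_mkcond; apply: eq_bigr => q _.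
  by rewrite /t /c; case: ifP; rewrite ?mulr0.
rewrite (@big_cat_nat _ _ _ M.+1) //= [X in _ + X]big_nat [X in _ + X]big1.
  rewrite addr0 big_add1 /= big_mkord; apply: eq_bigr => m _.
  exact: E2.
(* For [m > M] all quotients are at most [Q], so the four truncated partial sums are empty. *)
move=> m /andP[Mm _]; have m0 : (0 < m)%N by apply: leq_trans Mm.
have le_Q z : (z <= X)%N -> (z %/ m <= Q)%N.
  move=> zX; rewrite -ltnS ltn_divLR //; apply: leq_ltn_trans zX _.
  by apply: leq_trans QM _; rewrite leq_mul2l Mm orbT.
by rewrite E2 // /multiple_sum !psum_small ?subrr // le_Q // /X; lia.
Qed.

Lemma multiple_sum_norm (R : realType) (g : nat -> R) (B : R) (Q m x H : nat) :
  (0 < m)%N -> (H < x)%N -> 0 <= B ->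
  (forall n, (0 < n <= x + H)%N -> `|g n| <= B) ->
  `|multiple_sum g Q m x H| <= ((2 * (H %/ m) + 2)%:R) * B.
Proof.
move=> m0 Hx B0 gB.
have step u : (u + H <= x + H)%N ->
    `|psum g Q ((u + H) %/ m) - psum g Q (u %/ m)| <= (H %/ m).+1%:R * B.
  move=> ux; apply: le_trans (psum_lip Q B0 _ _) _.
  - move=> n /andP[n0 nu]; apply: gB; rewrite n0 /= (leq_trans nu) //.
    by rewrite (leq_trans (leq_div _ _)).
  - by rewrite leq_div2r // leq_addr.
  rewrite ler_wpM2r // ler_nat (divnD u H m0).
  move: (leq_b1 (m <= u %% m + H %% m)%N); move: (nat_of_bool _) (u %/ m)%N (H %/ m)%N => b p q b1.
  by clear -b1; lia.
rewrite /multiple_sum; apply: le_trans (ler_normB _ _) _.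
have := step x (leqnn _); have := step (x - H.+1)%N.
have -> : (x - H.+1 + H = x.-1)%N by lia.
move=> h1 h2; have {}h1 := h1 (leq_trans (leq_pred _) (leq_addr _ _)).
apply: le_trans (lerD h2 h1) _.
by rewrite -mulrDl -natrD ler_wpM2r // ler_nat; lia.
Qed.

Lemma multiple_sum_eq0 (R : realType) (g : nat -> R) (Q m x H : nat) :
  (0 < m)%N -> (x + H < m * Q.+1)%N -> multiple_sum g Q m x H = 0.
Proof.
move=> m0 le; have le_Q z : (z <= x + H)%N -> (z %/ m <= Q)%N.
  by move=> zX; rewrite -ltnS ltn_divLR // mulnC; apply: leq_ltn_trans le.
by rewrite /multiple_sum !psum_small ?subrr // le_Q //; lia.
Qed.

(** When all four arguments lie beyond [Q], the cut only subtracts the constant [psum g 0 Q] from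
    each partial sum, and this cancels. *)
Lemma multiple_sum_full (R : realType) (g : nat -> R) (Q m x H : nat) :
  (0 < m)%N -> (m * Q <= x - H.+1)%N ->
  multiple_sum g Q m x H = multiple_sum g 0 m x H.
Proof.
move=> m0 le; have P z : (x - H.+1 <= z)%N ->
    psum g Q (z %/ m) = psum g 0 (z %/ m) - psum g 0 Q.
  move=> xz; rewrite psumB // leq_divRL // mulnC; exact: leq_trans xz.
by rewrite /multiple_sum !P; [ring|lia..].
Qed.

(** Rounding moves the arguments [y + h], [y] and [y - h] by at most 1, 1 and 2 respectively, where
    only the second copy of [y] moves; hence the constant 4. *)
Lemma multiple_sum_approx (R : realType) (g : nat -> R) (B : R) (m x H : nat) :
  (0 < m)%N -> (H < x)%N -> 0 <= B ->
  (forall n, (0 < n <= x + H)%N -> `|g n| <= B) ->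
  `|multiple_sum g 0 m x H - second_diff g (x %/ m) (H %/ m)| <= 4 * B.
Proof.
move=> m0 Hx B0 gB; set y := (x %/ m)%N; set h := (H %/ m)%N.
have hy : (h <= y)%N by rewrite leq_div2r // ltnW.
have e1 : (y + h <= (x + H) %/ m <= y + h + 1)%N.
  by rewrite (divnD x H m0) -/y -/h; case: (m <= _)%N => /=; lia.
have e3 : (x.-1 %/ m <= y <= x.-1 %/ m + 1)%N.
  have Ex : x = (x.-1 + 1)%N by lia.
  have -> : y = (x.-1 %/ m + 1 %/ m + (m <= x.-1 %% m + 1 %% m))%N.
    by rewrite /y {1}Ex (divnD x.-1 1 m0).
  have : (1 %/ m + (m <= x.-1 %% m + 1 %% m) <= 1)%N.
    case: m m0 {y h hy e1} => // -[|m] _; first by rewrite !modn1 divn1.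
    by rewrite divn_small // leq_b1.
  move: (nat_of_bool _) (1 %/ m)%N (x.-1 %/ m)%N => b p q bp.
  by clear -bp; lia.
have e4 : ((x - H.+1) %/ m <= y - h <= (x - H.+1) %/ m + 2)%N.
  have E : (x.-1 = (x - H.+1) + H)%N by clear -Hx; lia.
  have := leq_b1 (m <= (x - H.+1) %% m + H %% m)%N.
  move: e3; rewrite E (divnD _ H m0) -/h.
  move: (nat_of_bool _) ((x - H.+1) %/ m)%N hy; clearbody y h; clear.
  by move=> b q; lia.
have lip u v : (u <= v)%N -> (v <= (x + H) %/ m)%N ->
    `|psum g 0 v - psum g 0 u| <= (v - u)%:R * B.
  move=> uv vx; apply: psum_lip => // n /andP[n0 nv]; apply: gB; rewrite n0 /=.
  by rewrite (leq_trans nv) // (leq_trans vx) // leq_div.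
rewrite /multiple_sum /second_diff -/y.
move: hy e1 e3 e4 lip; clearbody y h.
move: ((x + H) %/ m)%N (x.-1 %/ m)%N ((x - H.+1) %/ m)%N; clear -B0.
move=> u1 u3 u4 hy /andP[e1 e1'] /andP[e3 e3'] /andP[e4 e4'] lip.
have l1 : `|psum g 0 u1 - psum g 0 (y + h)| <= B.
  apply: le_trans (lip _ _ e1 (leqnn _)) _.
  by rewrite ler_piMl // lern1; lia.
have l3 : `|psum g 0 y - psum g 0 u3| <= B.
  apply: le_trans (lip _ _ e3 _) _; first by lia.
  by rewrite ler_piMl // lern1; lia.
have l4 : `|psum g 0 (y - h) - psum g 0 u4| <= 2 * B.
  apply: le_trans (lip _ _ e4 _) _; first by lia.
  by rewrite ler_wpM2r // ler_nat; lia.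
move: l1 l3 l4; rewrite !ler_norml; lra.
Qed.

(** With T the translation by [h], this is (T^r - 1)^2 = (T - 1)^2 (1 + T + ... + T^(r-1))^2,
    obtained by telescoping twice. *)
Lemma second_diff_muln (R : realType) (g : nat -> R) (x r h : nat) :
  (r * h <= x)%N ->
  second_diff g x (r * h) = \sum_(i < r) \sum_(j < r)
     second_diff g (x - r * h + (i + j).+1 * h) h.
Proof.
move=> rhx; set u := (x - r * h)%N; set A := psum g 0.
have tel (F : nat -> R) n : \sum_(i < n) (F i.+1 - F i) = F n - F 0%N.
  by rewrite -(big_mkord predT (fun i => F i.+1 - F i)) telescope_sumr.
pose D v := A (v + h)%N - A v.
have Dr v : \sum_(i < r) D (v + i * h)%N = A (v + r * h)%N - A v.
  have := tel (fun i => A (v + i * h)%N) r; rewrite /= mul0n addn0 => <-.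
  by apply: eq_bigr => i _; rewrite /D mulSnr addnA.
have E i : \sum_(j < r) second_diff g (u + (i + j).+1 * h) h =
    D (x + i * h)%N - D (u + i * h)%N.
  have -> : (x + i * h = u + i * h + r * h)%N by rewrite addnAC subnK.
  have := tel (fun j => D (u + i * h + j * h)%N) r; rewrite mul0n addn0 => <-.
  apply: eq_bigr => j _.
  rewrite /second_diff /D -/A.
  have -> : (u + (i + j).+1 * h - h = u + i * h + j * h)%N by rewrite mulSnr mulnDl; lia.
  have -> : (u + (i + j).+1 * h = u + i * h + j.+1 * h)%N by rewrite !mulSnr mulnDl; lia.
  have -> : (u + i * h + j * h + h = u + i * h + j.+1 * h)%N by rewrite mulSnr; lia.
  ring.
rewrite (eq_bigr _ (fun (i : 'I_r) _ => E i)) sumrB !Dr /second_diff -/A.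
have -> : (u + r * h = x)%N by rewrite subnK.
by rewrite /u; ring.
Qed.

(** * Mean square inequalities *)

Lemma cauchy_weighted (R : realType) (M : nat) (w a : nat -> R) :
  (forall i, 0 < w i) ->
  (\sum_(i < M) a i) ^+ 2 <= (\sum_(i < M) w i) * \sum_(i < M) a i ^+ 2 / w i.
Proof.
move=> w0; rewrite expr2 !big_distrlr /= -(ler_pM2l (@ltr0Sn R 1)).
have -> : 2 * (\sum_(i < M) \sum_(j < M) w i * (a j ^+ 2 / w j)) =
    \sum_(i < M) \sum_(j < M) (w i * (a j ^+ 2 / w j) + w j * (a i ^+ 2 / w i)).
  rewrite mulr_natl mulr2n {2}exchange_big /= -big_split /=.
  by apply: eq_bigr => i _; rewrite -big_split.
rewrite mulr_sumr; apply: ler_sum => i _; rewrite mulr_sumr; apply: ler_sum => j _.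
have wi := w0 i; have wj := w0 j.
rewrite -subr_ge0.
have -> : w i * (a j ^+ 2 / w j) + w j * (a i ^+ 2 / w i) - 2 * (a i * a j) =
   (w i * a j - w j * a i) ^+ 2 / (w i * w j).
  by field; rewrite !gt_eqF.
by rewrite divr_ge0 ?sqr_ge0 // mulr_ge0 // ltW.
Qed.

Lemma sqr_sum_le (R : realType) (M : nat) (a : nat -> R) :
  (\sum_(i < M) a i) ^+ 2 <= M%:R * \sum_(i < M) a i ^+ 2.
Proof.
have := @cauchy_weighted R M (fun=> 1) a (fun=> ltr01).
rewrite sumr_const card_ord => /le_trans; apply.
by rewrite ler_wpM2l // ler_sum // => i _; rewrite divr1.
Qed.

Lemma sqrD_le (R : realType) (a b : R) : (a + b) ^+ 2 <= 2 * a ^+ 2 + 2 * b ^+ 2.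
Proof. by rewrite -subr_ge0 (_ : _ - _ = (a - b) ^+ 2) ?sqr_ge0 //; ring. Qed.

Lemma ler_sum_nat_sub (R : realType) (a b c d : nat) (F : nat -> R) :
  (forall x, 0 <= F x) -> (c <= a)%N -> (b <= d)%N ->
  \sum_(a <= x < b) F x <= \sum_(c <= x < d) F x.
Proof.
move=> F0 ca bd; have [ab|ba] := leqP a b; last first.
  by rewrite big_geq ?(ltnW ba) // sumr_ge0.
rewrite (@big_cat_nat _ _ _ a c) //=; last exact: leq_trans ab bd.
rewrite (@big_cat_nat _ _ _ b a d) //= addrCA lerDl addr_ge0 // sumr_ge0 //.
Qed.

Lemma sum_indicator_le (R : realType) (a b c d : nat) :
  \sum_(a <= x < b) (if (c <= x < d)%N then 1 else 0) <= (d - c)%:R :> R.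
Proof.
pose F x : R := if (c <= x < d)%N then 1 else 0.
have F0 x : 0 <= F x by rewrite /F; case: ifP.
apply: le_trans (ler_sum_nat_sub (c := minn a c) (d := maxn b d) F0 _ _) _.
- exact: geq_minl.
- exact: leq_maxl.
have [cd|dc] := leqP c d; last first.
  rewrite big1 ?ler0n // => x _; rewrite /F.
  by case: ifP => // /andP[cx xd]; have := leq_ltn_trans cx xd; lia.
rewrite (@big_cat_nat _ _ _ c) /=; [|exact: geq_minr|lia].
rewrite (@big_cat_nat _ _ _ d c) /=; [|exact: cd|exact: leq_maxr].
rewrite big_nat big1 => [|x /andP[_ xc]]; last by rewrite /F leqNgt xc.
rewrite add0r [X in _ + X]big_nat [X in _ + X]big1 => [|x /andP[dx _]]; last first.
  by rewrite /F [(x < d)%N]ltnNge dx andbF.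
rewrite addr0 big_nat (eq_bigr (fun=> 1)) => [|x /andP[h1 h2]]; last by rewrite /F h1 h2.
by rewrite -big_nat big_const_nat iter_addr addr0.
Qed.

(** Every quotient is taken at most [m] times, and for [x <= 2 * N] none exceeds [2 * (N %/ m) + 1],
    whence the upper limit. *)
Lemma sum_divn_le (R : realType) (N m : nat) (F : nat -> R) :
  (0 < m)%N -> (forall y, 0 <= F y) ->
  \sum_(N.+1 <= x < (2 * N).+1) F (x %/ m)%N <=
  m%:R * \sum_(N %/ m <= y < (2 * (N %/ m)).+2) F y.
Proof.
move=> m0 F0; set K := (2 * (N %/ m)).+2.
pose F' y := if (N %/ m <= y)%N then F y else 0.
have F'0 y : 0 <= F' y by rewrite /F'; case: ifP.
have -> : \sum_(N.+1 <= x < (2 * N).+1) F (x %/ m)%N =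
   \sum_(N.+1 <= x < (2 * N).+1) F' (x %/ m)%N.
  rewrite big_nat [RHS]big_nat; apply: eq_bigr => x /andP[Nx _].
  by rewrite /F' leq_div2r // ltnW.
have NK : (2 * N < m * K)%N.
  have := ltn_ceil N m0; rewrite /K mulSn -addn1 => ?; lia.
apply: (@le_trans _ _ (\sum_(0 <= x < m * K) F' (x %/ m)%N)).
  exact: (@ler_sum_nat_sub _ _ _ _ _ (fun x => F' (x %/ m)%N)).
rewrite big_mkord (sum_ord_mul m K (fun x => F' (x %/ m)%N)).
have -> : \sum_(N %/ m <= y < K) F y = \sum_(j < K) F' j.
  rewrite -(big_mkord predT) (@big_cat_nat _ _ _ (N %/ m) 0%N K) //=; last by rewrite /K; lia.
  rewrite [X in X + _]big_nat [X in X + _]big1 ?add0r => [|y /andP[_ yN]]; last first.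
    by rewrite /F' leqNgt yN.
  by rewrite big_nat [RHS]big_nat; apply: eq_bigr => y /andP[h _]; rewrite /F' h.
rewrite mulr_sumr; apply: ler_sum => j _.
rewrite (eq_bigr (fun=> F' j)) ?sumr_const ?card_ord ?mulr_natl // => i _.
by rewrite addnC divnMDl // divn_small ?addn0.
Qed.

(** * Mean squares of second differences, over the range of quotients in [sum_divn_le] *)

Definition second_diff_energy (R : realType) (g : nat -> R) (N h : nat) : R :=
  \sum_(N <= y < (2 * N).+2) second_diff g y h ^+ 2.

Lemma second_diff_energy_ge0 (R : realType) (g : nat -> R) (N h : nat) :
  0 <= second_diff_energy g N h.
Proof. by rewrite sumr_ge0 // => y _; exact: sqr_ge0. Qed.

(** The summand vanishes for [x] well below [m * Q], and well above it equals the uncut sum, which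
    [second_diff] approximates within [4 * B]. The at most [2 * H] points in between, marked by
    [bad], are bounded trivially. *)
Lemma multiple_sum_energy (R : realType) (g : nat -> R) (B : R) (Q m N H : nat) :
  (0 < m)%N -> (H <= N)%N -> 0 <= B ->
  (forall n, (0 < n <= 3 * N)%N -> `|g n| <= B) ->
  \sum_(N.+1 <= x < (2 * N).+1) multiple_sum g Q m x H ^+ 2 <=
  2 * m%:R * second_diff_energy g (N %/ m) (H %/ m) + 32 * B ^+ 2 * N%:R
  + 16 * B ^+ 2 * H%:R * ((H%:R / m%:R) ^+ 2 + 1).
Proof.
move=> m0 HN B0 gB.
pose bad x : R := if (m * Q + 1 - H <= x < m * Q + H + 1)%N then 1 else 0.
apply: (@le_trans _ _ (\sum_(N.+1 <= x < (2 * N).+1)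
   (2 * second_diff g (x %/ m) (H %/ m) ^+ 2 + 32 * B ^+ 2
    + 8 * B ^+ 2 * ((H%:R / m%:R) ^+ 2 + 1) * bad x))).
  rewrite big_nat [leRHS]big_nat; apply: ler_sum => x /andP[Nx xN].
  have Hx : (H < x)%N by apply: leq_ltn_trans Nx.
  have gBx n : (0 < n <= x + H)%N -> `|g n| <= B.
    by move=> /andP[n0 nx]; apply: gB; lia.
  have D0 : 0 <= second_diff g (x %/ m) (H %/ m) ^+ 2 by exact: sqr_ge0.
  have B20 : 0 <= B ^+ 2 by exact: sqr_ge0.
  have HB0 : 0 <= 8 * B ^+ 2 * ((H%:R / m%:R) ^+ 2 + 1).
    by rewrite !mulr_ge0 // addr_ge0 // sqr_ge0.
  rewrite /bad; case: ifP => [_|nb].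
    have /ler_normlP := multiple_sum_norm Q m0 Hx B0 gBx.
    have Hm : (H %/ m)%:R <= H%:R / m%:R :> R.
      by rewrite ler_pdivlMr ?ltr0n // -natrM ler_nat leq_trunc_div.
    move=> T; rewrite mulr1; apply: ler_wpDl; first by rewrite addr_ge0 // mulr_ge0.
    rewrite -real_normK ?num_real //.
    apply: (@le_trans _ _ ((2 * (H%:R / m%:R) + 2) ^+ 2 * B ^+ 2)).
      rewrite -exprMn lerXn2r ?nnegrE ?normr_ge0 //.
        by rewrite !(mulr_ge0, addr_ge0, invr_ge0).
      apply: le_trans (multiple_sum_norm Q m0 Hx B0 gBx) _.
      by rewrite ler_wpM2r // natrD natrM lerD2r ler_wpM2l.
    rewrite [leRHS]mulrAC ler_wpM2r //; apply: le_trans (sqrD_le _ _) _.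
    by rewrite exprMn; lra.
  have [xQ|Qx] := leqP x (m * Q).
    rewrite multiple_sum_eq0 ?expr0n //=; first by lra.
    rewrite mulnS; lia.
  rewrite multiple_sum_full //; last by lia.
  rewrite mulr0 addr0 -[multiple_sum _ _ _ _ _](subrK (second_diff g (x %/ m) (H %/ m))).
  apply: le_trans (sqrD_le _ _) _; rewrite addrC lerD2l.
  rewrite -real_normK ?num_real //.
  have -> : 32 * B ^+ 2 = 2 * (4 * B) ^+ 2 by ring.
  rewrite ler_wpM2l // lerXn2r ?nnegrE ?mulr_ge0 ?normr_ge0 //.
  exact: multiple_sum_approx.
rewrite !big_split /= -!mulr_sumr !lerD //.
- rewrite -mulrA ler_wpM2l //.
  exact: (@sum_divn_le _ _ _ (fun y => second_diff g y (H %/ m) ^+ 2) m0 (fun _ => sqr_ge0 _)).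
- rewrite big_const_nat iter_addr addr0 -[B *+ _]mulr_natl.
  have -> : ((2 * N).+1 - N.+1 = N)%N by lia.
  by rewrite le_eqVlt; apply/orP; left; apply/eqP; ring.
- have -> : 16 * B ^+ 2 * H%:R * ((H%:R / m%:R) ^+ 2 + 1) =
    8 * B ^+ 2 * ((H%:R / m%:R) ^+ 2 + 1) * (2 * H%:R) by ring.
  rewrite ler_wpM2l //; first by rewrite !mulr_ge0 ?sqr_ge0 // addr_ge0 ?sqr_ge0.
  apply: le_trans (sum_indicator_le _ _ _ _ _) _.
  by rewrite -natrM ler_nat; lia.
Qed.

(** Cauchy-Schwarz with weights [1 / m] multiplies the mean square for [m] by [m]. The transition
    points then contribute [H ^ 3 / m], which sums harmonically, and the other errors are at most a
    multiple of [N * M] for each [m]. *)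
Lemma large_divisors_energy (R : realType) (g : nat -> R) (B : R) (Q M N H : nat) :
  (H <= N)%N -> 0 <= B -> (forall n, (0 < n <= 3 * N)%N -> `|g n| <= B) ->
  \sum_(N.+1 <= x < (2 * N).+1) (\sum_(m < M) multiple_sum g Q m.+1 x H) ^+ 2 <=
  harm R M * (\sum_(m < M) 2 * m.+1%:R ^+ 2 *
     second_diff_energy g (N %/ m.+1) (H %/ m.+1)
   + 48 * B ^+ 2 * N%:R * M%:R ^+ 2 + 16 * B ^+ 2 * H%:R ^+ 3 * harm R M).
Proof.
move=> HN B0 gB.
have h0 n : 0 <= harm R n by rewrite sumr_ge0 // => i _; rewrite invr_ge0.
apply: (@le_trans _ _ (\sum_(N.+1 <= x < (2 * N).+1) harm R M *
    (\sum_(m < M) m.+1%:R * multiple_sum g Q m.+1 x H ^+ 2))).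
  apply: ler_sum => x _.
  apply: le_trans (@cauchy_weighted R M (fun m => m.+1%:R^-1)
    (fun m => multiple_sum g Q m.+1 x H) _) _.
    by move=> i; rewrite invr_gt0.
  apply: ler_wpM2l; first exact: h0.
  by apply: ler_sum => m _; rewrite invrK mulrC.
rewrite -mulr_sumr ler_wpM2l // exchange_big /=.
apply: (@le_trans _ _ (\sum_(m < M) (2 * m.+1%:R ^+ 2 *
     second_diff_energy g (N %/ m.+1) (H %/ m.+1) + 48 * B ^+ 2 * N%:R * M%:R
     + 16 * B ^+ 2 * H%:R ^+ 3 * m.+1%:R^-1))).
  apply: ler_sum => m _; rewrite -mulr_sumr.
  apply: le_trans (ler_wpM2l _ (@multiple_sum_energy R g B Q m.+1 N H _ HN B0 gB)) _ => //.
  rewrite !mulrDr -!addrA lerD //; first by rewrite le_eqVlt; apply/orP; left; apply/eqP; ring.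
  have mn0 : m.+1%:R != 0 :> R by rewrite pnatr_eq0.
  have mM : m.+1%:R <= M%:R :> R by rewrite ler_nat ltn_ord.
  have HNr : H%:R <= N%:R :> R by rewrite ler_nat.
  have e1 : m.+1%:R * (16 * B ^+ 2 * H%:R * (H%:R / m.+1%:R) ^+ 2) =
     16 * B ^+ 2 * H%:R ^+ 3 * m.+1%:R^-1.
    by move: (m.+1%:R : R) mn0 {mM} => t tn; field.
  rewrite e1 addrCA addrC lerD2r mulr1.
  apply: (@le_trans _ _ (M%:R * (32 * B ^+ 2 * N%:R) + M%:R * (16 * B ^+ 2 * N%:R))).
    rewrite lerD // ler_pM ?mulr_ge0 ?sqr_ge0 //.
    by rewrite ler_wpM2l ?mulr_ge0 ?sqr_ge0.
  by rewrite le_eqVlt; apply/orP; left; apply/eqP; ring.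
rewrite !big_split /= sumr_const card_ord -mulr_sumr -[X in _ + X + _]mulr_natl.
by rewrite le_eqVlt; apply/orP; left; apply/eqP; rewrite /harm; ring.
Qed.

Lemma symmetry_integral_conv_le (R : realType) (g : nat -> R) (B : R)
    (Q M N H Z k : nat) :
  (0 < N)%N -> (H <= N)%N -> 0 <= B ->
  (forall n, (0 < n <= 3 * N)%N -> `|g n| <= B) ->
  (Q <= N)%N -> (M <= N)%N -> (3 * N < Q.+1 * M.+1)%N -> (N <= Z)%N ->
  symmetry_integral (dirichlet_conv g (fun=> 1)) N H <=
  2 * (2 ^+ k.+1 * Z%:R * (B ^+ 2 * (2 * H%:R * harm R Q ^+ 3
     + 2 * Q%:R ^+ 2 * (Q%:R ^+ 2 / (2 * Z)%:R) ^+ k.+1)))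
  + 2 * (harm R M * (\sum_(m < M) 2 * m.+1%:R ^+ 2 *
     second_diff_energy g (N %/ m.+1) (H %/ m.+1)
   + 48 * B ^+ 2 * N%:R * M%:R ^+ 2 + 16 * B ^+ 2 * H%:R ^+ 3 * harm R M)).
Proof.
move=> N0 HN B0 gB QN MN QM NZ; rewrite /symmetry_integral.
pose S x := \sum_(q < Q) g q.+1 * sign_count R H q.+1 (x - H.+1).
apply: (@le_trans _ _ (\sum_(N.+1 <= x < (2 * N).+1)
  (2 * S x ^+ 2 + 2 * (\sum_(m < M) multiple_sum g Q m.+1 x H) ^+ 2))).
  rewrite big_nat [leRHS]big_nat; apply: ler_sum => x /andP[Nx xN].
  rewrite real_normK ?num_real // (@symmetry_sum_conv _ _ _ _ Q M); last 1 first.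
  - by apply: leq_ltn_trans QM; lia.
  - exact: sqrD_le.
  - by lia.
  - by lia.
  - by lia.
rewrite big_split /= -!mulr_sumr lerD // ler_wpM2l //; last exact: large_divisors_energy.
have Z0 : (0 < Z)%N by lia.
apply: le_trans (@large_sieve R g B H Q Z k (N - H) Z0 _); last first.
  by move=> q /andP[q0 qQ]; apply: gB; lia.
(* By positivity the [N] points starting at [N - H] are extended to a block of [Z] points, so that
   the averaging windows may be longer than [Q ^ 2]. *)
have -> : Z = ((2 * N).+1 - N.+1 + (Z - N))%N by lia.
rewrite big_split_ord /= -{1}[N.+1]add0n big_addn big_mkord.
apply: ler_wpDr; first by rewrite sumr_ge0 // => i _; exact: sqr_ge0.
rewrite le_eqVlt; apply/orP; left; apply/eqP; apply: eq_bigr => i _.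
congr (_ ^+ 2); apply: eq_bigr => q _; congr (_ * sign_count _ _ _ _).
by lia.
Qed.

(** Dropping the remainder [s] costs at most [r * B] at each end. Length [r * h] is then a sum of
    [r ^ 2] translates of length [h], and two applications of Cauchy-Schwarz give the factor
    [r ^ 4]. *)
Lemma second_diff_energy_transfer (R : realType) (g : nat -> R) (B : R)
    (N r h s : nat) :
  (4 <= N)%N -> (4 * (r * h + s) <= N)%N -> (0 < r)%N -> (s <= r)%N -> 0 <= B ->
  (forall n, (0 < n <= 5 * N)%N -> `|g n| <= B) ->
  second_diff_energy g N (r * h + s) <=
  4 * r%:R ^+ 4 * (symmetry_integral g (uphalf N) h + symmetry_integral g N h
     + symmetry_integral g (2 * N) h) + 272 * B ^+ 2 * r%:R ^+ 4 * N%:R.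
Proof.
move=> N4 hN r0 sr B0 gB.
have B20 : 0 <= B ^+ 2 by exact: sqr_ge0.
have r1 : 1 <= r%:R :> R by rewrite ler1n.
pose c := (N - r * h)%N; pose d := (2 * N + 2 + r * h)%N.
pose W := \sum_(c <= y < d) second_diff g y h ^+ 2.
have hrh : (h <= r * h)%N by rewrite leq_pmull.
have sd y : (N <= y < (2 * N).+2)%N ->
    second_diff g y (r * h + s) ^+ 2 <=
    2 * second_diff g y (r * h) ^+ 2 + 8 * r%:R ^+ 2 * B ^+ 2.
  move=> /andP[Ny yN].
  rewrite -[second_diff g y (r * h + s)](subrK (second_diff g y (r * h))).
  apply: le_trans (sqrD_le _ _) _; rewrite addrC lerD2l.
  have -> : 8 * r%:R ^+ 2 * B ^+ 2 = 2 * (2 * r%:R * B) ^+ 2 by ring.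
  rewrite ler_wpM2l // -real_normK ?num_real //.
  rewrite lerXn2r ?nnegrE ?mulr_ge0 ?normr_ge0 //.
  have lip u v : (u <= v)%N -> (v <= 5 * N)%N -> (v - u <= r)%N ->
      `|psum g 0 v - psum g 0 u| <= r%:R * B.
    move=> uv vx vu; apply: le_trans (psum_lip 0 B0 _ uv) _.
      by move=> n /andP[n0 nv]; apply: gB; rewrite n0 (leq_trans nv).
    by rewrite ler_wpM2r // ler_nat.
  have l1 := lip (y + r * h)%N (y + (r * h + s))%N.
  have l2 := lip (y - (r * h + s))%N (y - r * h)%N.
  have {}l1 : `|psum g 0 (y + (r * h + s)) - psum g 0 (y + r * h)| <= r%:R * B.
    by apply: l1; lia.
  have {}l2 : `|psum g 0 (y - r * h) - psum g 0 (y - (r * h + s))| <= r%:R * B.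
    by apply: l2; lia.
  rewrite /second_diff; move: l1 l2; rewrite !ler_norml; lra.
have step1 : second_diff_energy g N (r * h + s) <=
    2 * \sum_(N <= y < (2 * N).+2) second_diff g y (r * h) ^+ 2
    + 16 * r%:R ^+ 2 * B ^+ 2 * N%:R.
  apply: (@le_trans _ _ (\sum_(N <= y < (2 * N).+2)
     (2 * second_diff g y (r * h) ^+ 2 + 8 * r%:R ^+ 2 * B ^+ 2))).
    by rewrite /second_diff_energy big_nat [leRHS]big_nat; exact: ler_sum.
  rewrite big_split /= -mulr_sumr lerD2l big_const_nat iter_addr addr0.
  rewrite -[_ *+ _]mulr_natl.
  have -> : 16 * r%:R ^+ 2 * B ^+ 2 * N%:R = (2 * N)%:R * (8 * r%:R ^+ 2 * B ^+ 2).
    by rewrite natrM; ring.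
  by rewrite ler_wpM2r ?mulr_ge0 ?sqr_ge0 // ler_nat; lia.
have step2 : \sum_(N <= y < (2 * N).+2) second_diff g y (r * h) ^+ 2 <= r%:R ^+ 4 * W.
  apply: (@le_trans _ _ (\sum_(N <= y < (2 * N).+2) r%:R ^+ 2 * \sum_(i < r) \sum_(j < r)
      second_diff g (y - r * h + (i + j).+1 * h) h ^+ 2)).
    rewrite big_nat [leRHS]big_nat; apply: ler_sum => y /andP[Ny yN].
    rewrite second_diff_muln; last by lia.
    apply: le_trans (@sqr_sum_le R r (fun i => \sum_(j < r)
      second_diff g (y - r * h + (i + j).+1 * h) h)) _.
    rewrite expr2 -mulrA ler_wpM2l // mulr_sumr ler_sum // => i _.
    exact: (@sqr_sum_le R r (fun j => second_diff g (y - r * h + (i + j).+1 * h) h)).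
  rewrite -mulr_sumr (_ : 4 = 2 + 2)%N // exprD -mulrA ler_wpM2l ?exprn_ge0 //.
  rewrite exchange_big /= expr2 -mulrA.
  have inner (i j : 'I_r) : \sum_(N <= y < (2 * N).+2)
      second_diff g (y - r * h + (i + j).+1 * h) h ^+ 2 <= W.
    pose e := ((i + j).+1 * h)%N.
    have eh : (e <= 2 * (r * h))%N.
      rewrite /e mulnA leq_mul2r; apply/orP; right.
      by have := ltn_ord i; have := ltn_ord j; lia.
    have -> : \sum_(N <= y < (2 * N).+2) second_diff g (y - r * h + e) h ^+ 2 =
       \sum_(N - r * h + e <= y < (2 * N).+2 - r * h + e) second_diff g y h ^+ 2.
      rewrite -{1}(subnK (_ : r * h <= N)%N); last by lia.
      rewrite big_addn -[X in \sum_(X <= _ < _) _ = _](addnK e).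
      rewrite [RHS]big_addn !addnK; apply: eq_big_nat => y _.
      by rewrite addnK.
    apply: (@ler_sum_nat_sub _ _ _ _ _ (fun y => second_diff g y h ^+ 2)).
    - by move=> y; exact: sqr_ge0.
    - by rewrite /c leq_addr.
    - by rewrite /d; lia.
  apply: (@le_trans _ _ (\sum_(i < r) \sum_(j < r) W)).
    apply: ler_sum => i _; rewrite exchange_big /=; apply: ler_sum => j _.
    exact: inner.
  by rewrite !sumr_const card_ord -mulrnA -[W *+ _]mulr_natl natrM mulrA.
have step3 : W <= 2 * (symmetry_integral g (uphalf N) h + symmetry_integral g N h
     + symmetry_integral g (2 * N) h) + 128 * B ^+ 2 * N%:R.
  (* The translates stay between N/2 and 4N, which three dyadic ranges cover. Rounding up in
     [uphalf N] makes the first of them reach [N]. *)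
  have d4 : (d <= (4 * N).+1)%N by rewrite /d; lia.
  have cN : ((uphalf N).+1 <= c)%N by rewrite /c; lia.
  pose F y := `|symmetry_sum g y h| ^+ 2.
  have F0 y : 0 <= F y by rewrite exprn_ge0.
  apply: (@le_trans _ _ (\sum_(c <= y < d) (2 * F y + 32 * B ^+ 2))).
    rewrite /W big_nat [leRHS]big_nat; apply: ler_sum => y /andP[cy yd].
    have hy : (h < y)%N by apply: leq_trans cy; rewrite /c; lia.
    rewrite /F real_normK ?num_real // symmetry_sumE //.
    have := @multiple_sum_approx R g B 1 y h isT hy B0; rewrite !divn1 => A.
    rewrite -[second_diff g y h](subrK (multiple_sum g 0 1 y h)).
    apply: le_trans (sqrD_le _ _) _; rewrite addrC lerD2l.
    have -> : 32 * B ^+ 2 = 2 * (4 * B) ^+ 2 by ring.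
    rewrite ler_wpM2l // -real_normK ?num_real //.
    rewrite lerXn2r ?nnegrE ?mulr_ge0 ?normr_ge0 // distrC; apply: A => n /andP[n0 nx].
    by apply: gB; lia.
  rewrite big_split /= -mulr_sumr lerD //; last first.
    rewrite big_const_nat iter_addr addr0 -[_ *+ _]mulr_natl.
    have -> : 128 * B ^+ 2 * N%:R = (4 * N)%:R * (32 * B ^+ 2).
      by rewrite natrM; ring.
    by rewrite ler_wpM2r ?mulr_ge0 // ler_nat; lia.
  rewrite ler_wpM2l //.
  apply: le_trans (@ler_sum_nat_sub _ _ _ (uphalf N).+1 (4 * N).+1 F F0 cN d4) _.
  rewrite (@big_cat_nat _ _ _ N.+1) /=; [|lia..].
  rewrite [X in _ + X](@big_cat_nat _ _ _ (2 * N).+1) /=; [|lia..].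
  rewrite addrA /symmetry_integral !lerD //.
    by apply: ler_sum_nat_sub => //; lia.
  by rewrite mulnA.
apply: le_trans step1 _.
have r24 : r%:R ^+ 2 <= r%:R ^+ 4 :> R by rewrite ler_weXn2l.
have N0 : 0 <= N%:R :> R by [].
apply: (@le_trans _ _ (2 * (r%:R ^+ 4 * (2 * (symmetry_integral g (uphalf N) h
     + symmetry_integral g N h + symmetry_integral g (2 * N) h) + 128 * B ^+ 2 * N%:R))
   + 16 * r%:R ^+ 4 * B ^+ 2 * N%:R)); last first.
  by rewrite le_eqVlt; apply/orP; left; apply/eqP; ring.
rewrite lerD //.
  rewrite ler_wpM2l //; apply: le_trans step2 _.
  by rewrite ler_wpM2l // exprn_ge0.
by rewrite !ler_wpM2r // ler_wpM2l.
Qed.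

(** * Uniformity in the length *)

Lemma bigO_natP (R : realType) (f g : nat -> R) :
  f =O_\oo g <-> exists (C : R) (N0 : nat), 0 < C /\
    forall N, (N0 <= N)%N -> `|f N| <= C * `|g N|.
Proof.
split=> [/eqO_exP[C C0 [N0 _ H]]|[C [N0 [C0 H]]]].
  by exists C, N0; split=> // N /H.
by apply/eqO_exP; exists C => //; exists N0.
Qed.

Lemma bigTheta_natP (R : realType) (f g : nat -> R) :
  f =Theta_\oo g <-> exists (c C : R) (N0 : nat), [/\ 0 < c, 0 < C &
    forall N, (N0 <= N)%N -> c * `|g N| <= `|f N| <= C * `|g N|].
Proof.
rewrite eqThetaE qualifE; split.
  move=> /asboolP[[c C] /= /andP[c0 C0] [N0 _ H]].
  by exists c, C, N0; split=> // N /H[-> ->].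
move=> [c [C [N0 [c0 C0 H]]]]; apply/asboolP; exists (c, C) => /=.
  by rewrite c0.
by exists N0 => // N /H /andP[].
Qed.

Lemma eventually_powR_le (R : realType) (C a b : R) : a < b ->
  exists N0, forall N, (N0 <= N)%N -> (0 < N)%N /\ C * N%:R `^ a <= N%:R `^ b.
Proof.
move=> ab; pose D := Num.max C 1; have D0 : 0 < D by rewrite lt_max ltr01 orbT.
have ba : 0 < b - a by rewrite subr_gt0.
exists (Num.truncn (D `^ (b - a)^-1)).+1 => N NN.
have N0 : (0 < N)%N by apply: leq_trans NN.
have Nr : D `^ (b - a)^-1 <= N%:R.
  by apply: ltW; apply: lt_le_trans (truncnS_gt _) _; rewrite ler_nat.
split=> //; rewrite -(subrK a b) powRD; last by rewrite pnatr_eq0 -lt0n N0 implybT.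
rewrite ler_wpM2r ?powR_ge0 //.
apply: (@le_trans _ _ D); first by rewrite le_max lexx.
have {1}-> : D = (D `^ (b - a)^-1) `^ (b - a).
  by rewrite -powRrM mulVf ?gt_eqF // powRr1 // ltW.
by apply: ge0_ler_powR; rewrite ?nnegrE ?powR_ge0 // ltW.
Qed.

Lemma truncn_ge_half (R : realType) (x : R) : 1 <= x -> x / 2 <= (Num.truncn x)%:R.
Proof.
move=> x1; have x0 : 0 <= x by lra.
have : 1 <= (Num.truncn x)%:R :> R by rewrite ler1n truncn_gt0.
by have := truncnS_gt x; rewrite -natr1; lra.
Qed.

Lemma powR_ge1 (R : realType) (x a : R) : 1 <= x -> 0 <= a -> 1 <= x `^ a.
Proof. by move=> x1 a0; rewrite -(powRr0 x); exact: ler_powR. Qed.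

(** For each [N] let [h N] be the worst length in the window, which is finite and contains the
    integer part of [N ^ theta]. This choice is itself an admissible sequence, and its constant
    serves every other length in the window. *)
Lemma uniform_in_scale (R : realType) (J : nat -> nat -> R) (theta kappa : R) :
  0 <= theta ->
  (forall h : nat -> nat,
     (fun N => (h N)%:R : R) =Theta_\oo (fun N => N%:R `^ theta : R) ->
     (fun N => J N (h N)) =O_\oo (fun N => N%:R * (h N)%:R `^ kappa : R)) ->
  exists (C : R) (N0 : nat), 0 < C /\ forall N h, (N0 <= N)%N ->
    N%:R `^ theta / 4 <= h%:R <= 4 * N%:R `^ theta ->
    `|J N h| <= C * (N%:R * h%:R `^ kappa).
Proof.
move=> th0 HJ.
pose w N h : R := N%:R * h%:R `^ kappa.
pose rg (N h : nat) : bool := N%:R `^ theta / 4 <= (h%:R : R) <= 4 * N%:R `^ theta.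
have [h hP] : {h : nat -> nat & forall N, (0 < N)%N -> rg N (h N) /\
    forall h', rg N h' -> `|J N h'| / w N h' <= `|J N (h N)| / w N (h N)}.
  apply: (@choice nat nat (fun N hN => (0 < N)%N -> rg N hN /\
    forall h', rg N h' -> `|J N h'| / w N h' <= `|J N hN| / w N hN)).
  case => [|n]; first by exists 0%N.
  set N := n.+1; pose T : R := N%:R `^ theta.
  have T1 : 1 <= T by rewrite powR_ge1 // ler1n.
  pose K := (Num.truncn (4 * T)).+1.
  have rgK i : rg N i -> (i < K)%N.
    move=> /andP[_ iT]; rewrite ltnS truncn_ge_nat //.
    by rewrite mulr_ge0 // powR_ge0.
  have rg0 : rg N (Num.truncn T).
    apply/andP; split; rewrite -/T.
      by have := truncn_ge_half T1; lra.
    have : (Num.truncn T)%:R <= T by rewrite truncn_le; lra.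
    lra.
  pose i0 : 'I_K := Ordinal (rgK _ rg0).
  case: (@arg_maxP _ _ 'I_K i0 (fun i => rg N i) (fun i => `|J N i| / w N i) rg0).
  move=> i rgi imax; exists i => _; split=> // h' rgh'.
  exact: (imax (Ordinal (rgK _ rgh')) rgh').
have hT : (fun N => (h N)%:R : R) =Theta_\oo (fun N => N%:R `^ theta : R).
  apply/bigTheta_natP; exists 4^-1, 4, 1%N; split=> // N N1.
  have [/andP[h1 h2] _] := hP N N1.
  by rewrite normr_nat (ger0_norm (powR_ge0 _ _)) mulrC h1 h2.
have /bigO_natP[C [N0 [C0 HC]]] := HJ h hT.
exists C, (maxn N0 1); split=> // N h'; rewrite geq_max => /andP[NN0 N1] rgh'.
have [rgh hmax] := hP N N1.
have wgt0 i : rg N i -> 0 < w N i.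
  move=> /andP[i1 _]; rewrite mulr_gt0 ?ltr0n // powR_gt0 //.
  by apply: lt_le_trans i1; rewrite divr_gt0 // powR_gt0 // ltr0n.
rewrite -ler_pdivrMr ?wgt0 //; apply: le_trans (hmax _ rgh') _.
rewrite ler_pdivrMr ?wgt0 //; apply: le_trans (HC N NN0) _.
by rewrite ger0_norm // ltW // wgt0.
Qed.

(** * Bounds by small powers: the coefficients and the harmonic sums *)

Lemma essentially_bounded_le (R : realType) (g : nat -> R) (eps : R) :
  essentially_bounded g -> 0 < eps ->
  exists C : R, 0 < C /\ forall X n, (0 < n <= X)%N -> `|g n| <= C * X%:R `^ eps.
Proof.
move=> gb e0; have /bigO_natP[C [N0 [C0 H]]] := gb _ e0.
exists (C + \sum_(i < N0) `|g i|).
have S0 : 0 <= \sum_(i < N0) `|g i| by exact: sumr_ge0.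
split=> [|X n /andP[n0 nX]]; first by rewrite ltr_wpDr.
have X1 : 1 <= X%:R `^ eps by rewrite powR_ge1 ?(ltW e0) // ler1n (leq_trans n0).
have [nN|Nn] := leqP N0 n.
  apply: le_trans (H n nN) _; rewrite ger0_norm ?powR_ge0 //.
  apply: (@le_trans _ _ (C * X%:R `^ eps)).
    by rewrite ler_wpM2l ?(ltW C0) // ge0_ler_powR ?nnegrE ?(ltW e0) // ler_nat.
  by rewrite ler_wpM2r ?powR_ge0 // lerDl.
apply: (@le_trans _ _ (C + \sum_(i < N0) `|g i|)).
  by rewrite (bigD1 (Ordinal Nn)) //= addrCA lerDl addr_ge0 ?sumr_ge0 // ltW.
by rewrite ler_peMr // addr_ge0 // ltW.
Qed.

Lemma harm_ge0 (R : realType) (n : nat) : 0 <= harm R n.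
Proof. by rewrite sumr_ge0 // => i _; rewrite invr_ge0. Qed.

Lemma harm_le_ln (R : realType) (n : nat) : harm R n.+1 <= 1 + ln n.+1%:R.
Proof.
elim: n => [|n IH]; first by rewrite /harm big_ord_recr big_ord0 /= ln1 invr1 add0r addr0.
rewrite /harm big_ord_recr /=; apply: le_trans (lerD IH (lexx _)) _.
rewrite -addrA lerD2l -lerBrDl.
have n1 : (0 : R) < n.+1%:R by rewrite ltr0n.
have n2 : (0 : R) < n.+2%:R by rewrite ltr0n.
have := @le_ln1Dx R (- n.+2%:R^-1) _.
have -> : 1 + - n.+2%:R^-1 = n.+1%:R / n.+2%:R :> R.
  by rewrite -[X in X / _](addrK 1) natr1 mulrBl mulfV ?gt_eqF // mul1r.
rewrite ln_div // => H.
have : ln n.+1%:R - ln n.+2%:R <= - n.+2%:R^-1 :> R.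
  by apply: H; rewrite ltrN2 invf_lt1 // ltr1n.
by move: (ln _) (ln _) (_^-1) => x y z; lra.
Qed.

(** Combines [harm R X <= 1 + ln X] with [1 + eps * ln X <= X ^ eps], an instance of 1 + u <= exp
    u. *)
Lemma harm_le_powR (R : realType) (eps : R) : 0 < eps ->
  exists C : R, 0 < C /\ forall n X, (n <= X)%N -> (0 < X)%N ->
    harm R n <= C * X%:R `^ eps.
Proof.
move=> e0; exists (1 + eps^-1); have ie0 : 0 < eps^-1 by rewrite invr_gt0.
split=> [|n X nX X0]; first by rewrite addr_gt0.
apply: (@le_trans _ _ (1 + ln X%:R)).
  case: X X0 nX => // X _ nX; apply: le_trans (harm_le_ln R X).
  rewrite -(subnKC nX) /harm big_split_ord /= lerDl.
  by apply: sumr_ge0 => i _; rewrite invr_ge0.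
have Xn0 : (X%:R == 0 :> R) = false by rewrite pnatr_eq0 eqn0Ngt X0.
have l0 : 0 <= ln X%:R :> R by rewrite ln_ge0 // ler1n.
have : 1 + eps * ln X%:R <= X%:R `^ eps by rewrite /powR Xn0; exact: expR_ge1Dx.
move=> H; apply: (@le_trans _ _ ((1 + eps^-1) * (1 + eps * ln X%:R))).
  rewrite mulrDl !mulrDr !mul1r mulr1 mulKf ?gt_eqF //.
  have : 0 <= eps * ln X%:R by rewrite mulr_ge0 // ltW.
  lra.
by rewrite ler_wpM2l // addr_ge0 // ltW.
Qed.

Lemma powR_natD (R : realType) (N : nat) (a b : R) : (0 < N)%N ->
  N%:R `^ (a + b) = N%:R `^ a * N%:R `^ b :> R.
Proof. by move=> N0; rewrite powRD // pnatr_eq0 -lt0n N0 implybT. Qed.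

Definition scale_bound (R : realType) (g : nat -> R) (G theta : R) : Prop :=
  forall h : nat -> nat,
    (fun N => (h N)%:R : R) =Theta_\oo (fun N => N%:R `^ theta : R) ->
    (fun N => symmetry_integral g N (h N)) =O_\oo
      (fun N => N%:R * (h N)%:R `^ (2 - G) : R).

(** The transfer between lengths evaluates one length at N/2, N and 2N. As [2 ^ theta <= 2], a
    window with factor 2 at [N] lies in the window with factor 4 at the neighbouring scale. *)
Lemma scale_window (R : realType) (theta : R) (h N n : nat) :
  0 <= theta <= 1 -> (0 < N)%N -> (N <= 2 * n)%N -> (n <= 2 * N)%N ->
  N%:R `^ theta / 2 <= h%:R <= 2 * N%:R `^ theta ->
  n%:R `^ theta / 4 <= h%:R <= 4 * n%:R `^ theta.
Proof.
move=> /andP[th0 th1] N0 Nn nN /andP[h1 h2].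
have two : 2 `^ theta <= 2 :> R by rewrite -[leRHS]powRr1 // ler_powR // ler1n.
have H a b : (a <= 2 * b)%N -> a%:R `^ theta <= 2 * b%:R `^ theta :> R.
  move=> ab; apply: (@le_trans _ _ ((2 * b)%:R `^ theta)).
    by rewrite ge0_ler_powR ?nnegrE // ler_nat.
  by rewrite natrM powRM // ler_wpM2r // powR_ge0.
have := H _ _ Nn; have := H _ _ nN; move: h1 h2.
move: (N%:R `^ theta) (n%:R `^ theta) (h%:R) => x y z; lra.
Qed.

(** Take [r] about [h / N ^ theta], so that [h %/ r] has order [N ^ theta] and is covered by the
    uniform bound. The transfer costs [r ^ 4], at most [N ^ (4 * delta)]. *)
Lemma second_diff_energy_local (R : realType) (g : nat -> R) (G theta delta : R) :
  essentially_bounded g -> 0 < G < 1 -> 0 < theta <= 1 -> 0 <= delta ->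
  scale_bound g G theta ->
  exists (C : R) (N0 : nat), 0 < C /\ forall N h, (N0 <= N)%N ->
    N%:R `^ theta <= h%:R <= N%:R `^ (theta + delta) -> (4 * h <= N)%N ->
    second_diff_energy g N h <= C * N%:R `^ (1 + 4 * delta) * h%:R `^ (2 - G).
Proof.
move=> gb /andP[G0 G1] /andP[th0 th1] de0 sb.
have [C [N0 [C0 HC]]] := uniform_in_scale (ltW th0) sb.
(* With exponent [theta / 2] the square [B ^ 2] is of order [N ^ theta], hence at most a constant
   times [h], and is absorbed by [h ^ (2 - G)]. *)
have [Cg [Cg0 HCg]] := @essentially_bounded_le R g (theta / 2) gb (divr_gt0 th0 (ltr0Sn _ _)).
exists (24 * C + 272 * (25 * Cg ^+ 2)), (maxn 4 (2 * N0)); split.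
  by rewrite addr_gt0 ?mulr_gt0 // exprn_gt0.
move=> N h; rewrite geq_max => /andP[N4 NN0] /andP[Th hT] hN.
have Npos : (0 < N)%N by lia.
have N1 : 1 <= N%:R :> R by rewrite ler1n.
pose T : R := N%:R `^ theta.
have T1 : 1 <= T by rewrite powR_ge1 // ltW.
have T0 : 0 < T by lra.
have h1 : 1 <= h%:R :> R by apply: le_trans T1 Th.
have h0 : (0 < h)%N by rewrite -(ler1n R).
pose r := Num.truncn (h%:R / T).
have hT1 : 1 <= h%:R / T by rewrite ler_pdivlMr // mul1r.
have r0 : (0 < r)%N by rewrite truncn_gt0.
have rle : r%:R <= h%:R / T by rewrite truncn_le; lra.
have rge : h%:R / T / 2 <= r%:R by exact: truncn_ge_half.
have rN : r%:R <= N%:R `^ delta.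
  apply: le_trans rle _; rewrite ler_pdivrMr // mulrC -powR_natD //.
pose h' := (h %/ r)%N; pose s := (h %% r)%N.
have hE : h = (r * h' + s)%N by rewrite mulnC -divn_eq.
have sr : (s <= r)%N by rewrite ltnW // ltn_pmod.
have h'h : (h' <= h)%N by exact: leq_div.
have win : N%:R `^ theta / 2 <= h'%:R <= 2 * N%:R `^ theta.
  rewrite -/T; apply/andP; split.
    apply: le_trans (truncn_ge_half T1) _; rewrite ler_nat leq_divRL //.
    rewrite -(ler_nat R) natrM; apply: (@le_trans _ _ (T * r%:R)).
      by rewrite ler_wpM2r // truncn_le ltW.
    by rewrite mulrC -ler_pdivlMr.
  have r0r : 0 < r%:R :> R by rewrite ltr0n.
  apply: (@le_trans _ _ (h%:R / r%:R)).
    by rewrite ler_pdivlMr // -natrM ler_nat leq_trunc_div.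
  rewrite ler_pdivrMr //; move: rge; rewrite -mulrA -invfM ler_pdivrMr ?mulr_gt0 //.
  lra.
have Jb n : (N0 <= n)%N -> (N <= 2 * n)%N -> (n <= 2 * N)%N ->
    symmetry_integral g n h' <= C * (2 * N%:R * h%:R `^ (2 - G)).
  move=> nN0 Nn nN; apply: le_trans (ler_norm _) _.
  apply: le_trans (HC n h' nN0 _) _.
    by apply: (scale_window _ Npos) => //; rewrite (ltW th0).
  rewrite ler_wpM2l ?(ltW C0) // ler_pM ?powR_ge0 //.
    by rewrite -natrM ler_nat.
  by rewrite ge0_ler_powR ?nnegrE ?ler_nat //; lra.
pose B := Cg * (5 * N)%:R `^ (theta / 2).
have B0 : 0 <= B by rewrite mulr_ge0 ?(ltW Cg0) // powR_ge0.
have H := @second_diff_energy_transfer R g B N r h' s N4 _ r0 sr B0 (HCg _).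
rewrite -hE in H; apply: le_trans (H hN) _.
have hG : h%:R <= h%:R `^ (2 - G) :> R by rewrite le1r_powR //; lra.
have B2 : B ^+ 2 <= 25 * Cg ^+ 2 * h%:R `^ (2 - G).
  rewrite /B exprMn -[X in Cg ^+ 2 * X]powR_mulrn ?powR_ge0 // -powRrM.
  rewrite divfK // [25 * _]mulrC -[leRHS]mulrA; apply: ler_wpM2l; first exact: sqr_ge0.
  rewrite natrM powRM // ler_pM ?powR_ge0 //.
    apply: (@le_trans _ _ (5 `^ 1)); last by rewrite powRr1 // ler_nat.
    by rewrite ler_powR // ler1n.
  by apply: le_trans Th hG.
have r4 : r%:R ^+ 4 <= N%:R `^ (4 * delta).
  rewrite mulrC powRrM -[_ `^ 4]/(_ `^ 4%:R) powR_mulrn ?powR_ge0 //.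
  by rewrite lerXn2r ?nnegrE ?powR_ge0.
have J3 : symmetry_integral g (uphalf N) h' + symmetry_integral g N h' +
   symmetry_integral g (2 * N) h' <= 6 * C * (N%:R * h%:R `^ (2 - G)).
  have j1 := Jb (uphalf N); have j2 := Jb N; have j3 := Jb (2 * N)%N.
  have {}j1 : symmetry_integral g (uphalf N) h' <= C * (2 * N%:R * h%:R `^ (2 - G)).
    by apply: j1; clear -N4 NN0; lia.
  have {}j2 : symmetry_integral g N h' <= C * (2 * N%:R * h%:R `^ (2 - G)).
    by apply: j2; clear -N4 NN0; lia.
  have {}j3 : symmetry_integral g (2 * N) h' <= C * (2 * N%:R * h%:R `^ (2 - G)).
    by apply: j3; clear -N4 NN0; lia.
  have -> : 6 * C * (N%:R * h%:R `^ (2 - G)) =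
    C * (2 * N%:R * h%:R `^ (2 - G)) + C * (2 * N%:R * h%:R `^ (2 - G))
    + C * (2 * N%:R * h%:R `^ (2 - G)) by ring.
  by rewrite !lerD.
have r40 : 0 <= r%:R ^+ 4 :> R by rewrite exprn_ge0.
set hh := h%:R `^ (2 - G) in hG B2 J3 *.
have hh0 : 0 <= hh by exact: powR_ge0.
apply: (@le_trans _ _ (4 * r%:R ^+ 4 * (6 * C * (N%:R * hh))
   + 272 * (25 * Cg ^+ 2 * hh) * r%:R ^+ 4 * N%:R)).
  apply: lerD; first by apply: ler_wpM2l => //; rewrite mulr_ge0.
  apply: ler_wpM2r => //; apply: ler_wpM2r => //; exact: ler_wpM2l.
have -> : 4 * r%:R ^+ 4 * (6 * C * (N%:R * hh)) +
   272 * (25 * Cg ^+ 2 * hh) * r%:R ^+ 4 * N%:R =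
   ((24 * C + 272 * (25 * Cg ^+ 2)) * N%:R * hh) * r%:R ^+ 4 by ring.
rewrite powR_natD // powRr1 //.
have -> : (24 * C + 272 * (25 * Cg ^+ 2)) * (N%:R * N%:R `^ (4 * delta)) * hh =
   ((24 * C + 272 * (25 * Cg ^+ 2)) * N%:R * hh) * N%:R `^ (4 * delta) by ring.
apply: ler_wpM2l; last exact: r4.
apply: mulr_ge0 => //; apply: mulr_ge0 => //; apply: addr_ge0.
  by apply: mulr_ge0 => //; exact: ltW.
by apply: mulr_ge0 => //; apply: mulr_ge0 => //; exact: sqr_ge0.
Qed.

Lemma second_diff_energy_range (R : realType) (g : nat -> R) (G theta1 theta2 eps : R) :
  essentially_bounded g -> 0 < G < 1 -> 0 < theta1 < theta2 -> theta2 <= 1 ->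
  0 < eps ->
  (forall theta, theta1 <= theta <= theta2 -> scale_bound g G theta) ->
  exists (delta C : R) (N0 : nat), [/\ 0 < delta, 0 < C &
    forall N h, (N0 <= N)%N ->
    N%:R `^ theta1 <= h%:R <= N%:R `^ (theta2 + delta) -> (4 * h <= N)%N ->
    second_diff_energy g N h <= C * N%:R `^ (1 + eps) * h%:R `^ (2 - G)].
Proof.
move=> gb G01 /andP[th0 th12] th21 e0 sb.
(* Large enough that [4 * delta <= eps]. *)
pose K := (Num.truncn (4 * (theta2 - theta1) / eps)).+1.
pose delta := (theta2 - theta1) / K%:R.
have K0 : 0 < K%:R :> R by rewrite ltr0n.
have d0 : 0 < delta by rewrite divr_gt0 // subr_gt0.
have de : 4 * delta <= eps.
  rewrite /delta mulrA ler_pdivrMr // [leRHS]mulrC -ler_pdivrMr // ltW //.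
  exact: truncnS_gt.
have dK : theta1 + K%:R * delta = theta2 by rewrite mulrC divfK ?gt_eqF // addrC subrK.
(* The windows start at [theta1 + k * delta] for [k] from 0 to [K]. The last one starts at [theta2]
   and overshoots it by [delta], which leaves room for the constants in the order of [H]. *)
suff [C [N0 [C0 H]]] : exists (C : R) (N0 : nat), 0 < C /\
    forall N h, (N0 <= N)%N ->
    N%:R `^ theta1 <= h%:R <= N%:R `^ (theta1 + K.+1%:R * delta) ->
    (4 * h <= N)%N ->
    second_diff_energy g N h <= C * N%:R `^ (1 + 4 * delta) * h%:R `^ (2 - G).
  exists delta, C, (maxn N0 1); split=> // N h.
  rewrite geq_max => /andP[NN0 N1] hh hN; apply: le_trans (H N h NN0 _ hN) _.
    by rewrite -natr1 mulrDl mul1r addrA dK.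
  rewrite ler_wpM2r ?powR_ge0 // ler_wpM2l ?(ltW C0) // ler_powR ?ler1n //.
  by rewrite lerD2l.
have : (K <= K)%N by [].
elim: {-2}K => [|k IH] kK.
  rewrite mul1r; apply: second_diff_energy_local => //.
  - by rewrite th0 /=; lra.
  - exact: ltW.
  - by apply: sb; rewrite lexx ltW.
have [C1 [N1 [C10 H1]]] := IH (ltnW kK).
have kd : 0 <= k.+1%:R * delta by rewrite mulr_ge0 // ltW.
have kdK : k.+1%:R * delta <= K%:R * delta by rewrite ler_wpM2r ?(ltW d0) // ler_nat.
have [C2 [N2 [C20 H2]]] : exists (C : R) (N0 : nat), 0 < C /\
    forall N h, (N0 <= N)%N ->
    N%:R `^ (theta1 + k.+1%:R * delta) <= h%:R
      <= N%:R `^ (theta1 + k.+1%:R * delta + delta) -> (4 * h <= N)%N ->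
    second_diff_energy g N h <= C * N%:R `^ (1 + 4 * delta) * h%:R `^ (2 - G).
  apply: second_diff_energy_local => //.
  - by apply/andP; split; lra.
  - exact: ltW.
  - by apply: sb; apply/andP; split; lra.
exists (C1 + C2), (maxn N1 N2); split; first by rewrite addr_gt0.
move=> N h; rewrite geq_max => /andP[NN1 NN2] /andP[h1 h2] hN.
have W C : C <= C1 + C2 ->
    C * N%:R `^ (1 + 4 * delta) * h%:R `^ (2 - G) <=
    (C1 + C2) * N%:R `^ (1 + 4 * delta) * h%:R `^ (2 - G).
  by move=> CC; rewrite !ler_wpM2r ?powR_ge0.
have [hl|hl] := lerP (h%:R) (N%:R `^ (theta1 + k.+1%:R * delta)).
  apply: le_trans (H1 N h NN1 _ hN) (W _ _); first by rewrite h1.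
  by rewrite lerDl ltW.
apply: le_trans (H2 N h NN2 _ hN) (W _ _); last by rewrite lerDr ltW.
by rewrite (ltW hl) -addrA -[X in _ + (_ + X)]mul1r -mulrDl natr1.
Qed.

(** * Optimisation of the cut *)

(** With [Q] about N^(1-d), [M] about N^d and [H] about N^v, the five exponents are those of N H,
    Q^2 H, N H^(2-G) M^G, N M^2 and H^3, each with [7 * e] to spare. The condition
    [d * (1 - t) + t < v] says that H/m exceeds (N/m)^t even for [m] as large as N^d. *)
Lemma exponent_choice (R : realType) (v G G' : R) :
  3^-1 < v < 1 -> 0 < G < 1 ->
  0 < G' < Num.min ((3 - v^-1) / (1 + 2 * G^-1)) (v^-1 - 1) ->
  exists d t e : R,
  [/\ [/\ 0 < d < 1, 0 < e & 0 < t < v],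
   (3 * v - 1) / ((1 - G) * v + G + 1) < t, d * (1 - t) + t < v &
   [/\ 1 + v + 7 * e <= 1 + v * (2 - G'),
    2 - 2 * d + v + 7 * e <= 1 + v * (2 - G'),
    1 + v * (2 - G) + d * G + 7 * e <= 1 + v * (2 - G'),
    1 + 2 * d + 7 * e <= 1 + v * (2 - G') &
    3 * v + 7 * e <= 1 + v * (2 - G')]].
Proof.
move=> /andP[v3 v1] /andP[G0 G1] /andP[G'0]; rewrite lt_min => /andP[c1 c2].
have v0 : 0 < v by apply: lt_trans v3; rewrite invr_gt0.
have {}v3 : 1 < 3 * v by move: v3; rewrite -[3^-1]mul1r ltr_pdivrMr //; lra.
pose x := v * G'.
have x0 : 0 < x by rewrite mulr_gt0.
have x2 : x < 1 - v.
  have : v * G' < v * (v^-1 - 1) by rewrite ltr_pM2l.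
  by rewrite mulrBr mulfV ?gt_eqF // mulr1.
have x1 : x * (2 + G) < G * (3 * v - 1).
  have E : (3 - v^-1) / (1 + 2 * G^-1) = G * (3 * v - 1) / (v * (2 + G)).
    by field; rewrite ?gt_eqF //=; lra.
  move: c1; rewrite E ltr_pdivlMr; last by rewrite mulr_gt0 //; lra.
  by rewrite /x; move=> H; have -> : v * G' * (2 + G) = G' * (v * (2 + G)) by ring.
(* The bound for Q^2 H requires [d] above [a], the range of [t] requires [d] below [D]. Both [a < D]
   and [D * G < v * G - x] amount to [x1], which is the first term of the minimum. *)
pose a := (1 - v + x) / 2.
pose D := (1 - (1 - G) * v) / (2 + G).
have G2 : 0 < 2 + G by lra.
have DE : D * (2 + G) = 1 - (1 - G) * v by rewrite divfK // gt_eqF.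
have Gv : 0 < G * v by rewrite mulr_gt0.
have Gv1 : G * v < v by rewrite -[ltRHS]mul1r ltr_pM2r.
have aD : a < D.
  rewrite -(ltr_pM2r G2) DE /a; lra.
have D1 : D < 1 by rewrite -(ltr_pM2r G2) DE; lra.
have a0 : 0 < a by rewrite /a; lra.
pose d := (a + D) / 2.
have da : a < d by rewrite /d; lra.
have dD : d < D by rewrite /d; lra.
have d0 : 0 < d by lra.
have d1 : d < 1 by lra.
pose E := (1 - G) * v + G + 1.
have E0 : 0 < E by rewrite /E; have : 0 < (1 - G) * v; [rewrite mulr_gt0 //; lra|lra].
pose t0 := (3 * v - 1) / E.
have t0E : t0 * E = 3 * v - 1 by rewrite divfK // gt_eqF.
have t00 : 0 < t0 by rewrite divr_gt0 //; lra.
(* The threshold [t0] of the hypothesis on [g] is exactly the [t] solving [d * (1 - t) + t = v] at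
   [d = D]. Since [d < D], some room above [t0] remains. *)
have keyE : (v - t0) * E = D * ((1 - t0) * E).
  have -> : (v - t0) * E = v * E - t0 * E by ring.
  have -> : (1 - t0) * E = E - t0 * E by ring.
  rewrite t0E; apply: (mulIf (lt0r_neq0 G2)).
  have -> : D * (E - (3 * v - 1)) * (2 + G) = D * (2 + G) * (E - (3 * v - 1)) by ring.
  by rewrite DE /E; ring.
have key : v - t0 = D * (1 - t0).
  by apply: (mulIf (lt0r_neq0 E0)); rewrite keyE mulrA.
have t01 : t0 < 1.
  rewrite -(ltr_pM2r E0) t0E mul1r /E.
  have : 0 < (2 + G) * (1 - v) by rewrite mulr_gt0 // subr_gt0.
  lra.
have dt0 : d * (1 - t0) + t0 < v.
  have : d * (1 - t0) < D * (1 - t0) by rewrite ltr_pM2r // subr_gt0.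
  lra.
(* The supremum of the admissible [t] for this [d]; any [t] strictly between [t0] and [ts] will
   do. *)
pose ts := (v - d) / (1 - d).
have d1' : 0 < 1 - d by lra.
have tsE : ts * (1 - d) = v - d by rewrite divfK // gt_eqF.
have t0ts : t0 < ts.
  rewrite -(ltr_pM2r d1') tsE; lra.
have tsv : ts < v.
  rewrite -(ltr_pM2r d1') tsE; have : d * v < d * 1 by rewrite ltr_pM2l.
  lra.
pose t := (t0 + ts) / 2.
have tt0 : t0 < t by rewrite /t; lra.
have tts : t < ts by rewrite /t; lra.
have dt : d * (1 - t) + t < v.
  have : t * (1 - d) < ts * (1 - d) by rewrite ltr_pM2r.
  rewrite tsE; lra.
have s1 : 0 < v - x.
  rewrite subr_gt0 -(ltr_pM2r G2); apply: lt_trans x1 _.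
  have : G * v < 1 * v by rewrite ltr_pM2r.
  lra.
have s3 : 0 < v * G - x - d * G.
  have h : d * G < D * G by rewrite ltr_pM2r.
  have : D * G < v * G - x.
    rewrite -(ltr_pM2r G2).
    have -> : D * G * (2 + G) = G * (D * (2 + G)) by ring.
    rewrite DE; have -> : (v * G - x) * (2 + G) = v * G * (2 + G) - x * (2 + G) by ring.
    lra.
  lra.
have s4 : 0 < 2 * v - x - 2 * d.
  rewrite -(pmulr_lgt0 _ G0).
  have : x * G < x * 1 by rewrite ltr_pM2l.
  lra.
have s2 : 0 < 2 * d - 1 + v - x by move: da; rewrite /a; lra.
have s5 : 0 < 1 - v - x by lra.
(* The smallest of the five slacks; [e] is a seventh of it. *)
pose m := Num.min (v - x) (Num.min (2 * d - 1 + v - x)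
  (Num.min (v * G - x - d * G) (Num.min (2 * v - x - 2 * d) (1 - v - x)))).
have m0 : 0 < m by rewrite !lt_min s1 s2 s3 s4.
have : m <= m by [].
rewrite {2}/m !le_min => /and5P[m1 m2 m3 m4 m5].
exists d, t, (m / 7); have -> : 7 * (m / 7) = m by rewrite mulrC divfK.
have -> : v * (2 - G') = 2 * v - x by rewrite /x; ring.
split.
- split; first by rewrite d0.
    by rewrite divr_gt0.
  by apply/andP; split; lra.
- exact: tt0.
- exact: dt.
- by split; lra.
Qed.

(** * Dilated lengths and the choice of [Q] and [M] *)

Lemma dilated_le (R : realType) (N H m : nat) (e G : R) :
  (0 < m)%N -> 0 <= e -> 0 < G < 1 ->
  m%:R ^+ 2 * ((N %/ m)%:R `^ (1 + e) * (H %/ m)%:R `^ (2 - G)) <=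
  N%:R `^ (1 + e) * H%:R `^ (2 - G) * m%:R `^ G * m%:R^-1.
Proof.
move=> m0 e0 /andP[G0 G1].
have mr0 : 0 < m%:R :> R by rewrite ltr0n.
have m1 : 1 <= m%:R :> R by rewrite ler1n.
have D (X : nat) (p : R) : 0 <= p ->
    (X %/ m)%:R `^ p <= X%:R `^ p * m%:R `^ (- p).
  move=> p0; rewrite -[- p]mulN1r powRrM powR_inv1 // -powRM //.
  rewrite ge0_ler_powR ?nnegrE ?mulr_ge0 ?invr_ge0 //.
  by rewrite ler_pdivlMr // -natrM ler_nat leq_trunc_div.
(* The powers of [m] balance to at most [m ^ (G - 1)], kept as [m ^ G / m] so that a harmonic sum
   can be factored out later. *)
have h1 : (N %/ m)%:R `^ (1 + e) <= N%:R `^ (1 + e) * m%:R^-1.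
  apply: le_trans (D N (1 + e) _) _; first by lra.
  rewrite ler_wpM2l ?powR_ge0 // -powR_inv1 // ler_powR //; lra.
have h2 : (H %/ m)%:R `^ (2 - G) <= H%:R `^ (2 - G) * (m%:R `^ G * m%:R ^- 2).
  apply: le_trans (D H (2 - G) _) _; first by lra.
  rewrite ler_wpM2l ?powR_ge0 // -powR_invn // -powR_natD // ler_powR //.
  by lra.
apply: (@le_trans _ _ (m%:R ^+ 2 * (N%:R `^ (1 + e) * m%:R^-1 *
   (H%:R `^ (2 - G) * (m%:R `^ G * m%:R ^- 2))))).
  by rewrite ler_wpM2l ?sqr_ge0 // ler_pM ?powR_ge0.
rewrite le_eqVlt; apply/orP; left; apply/eqP.
by field; rewrite gt_eqF.
Qed.

(** Places the pairs [(N %/ m, H %/ m)], uniformly in [m], where the energy bound is available. The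
    lower bound on the length comes from [d * (1 - t) + t < v], the upper one uses [delta] to absorb
    [2 * c2], and the last claim uses [v < 1]. *)
Lemma dilated_scale (R : realType) (v t d delta c1 c2 : R) (K0 : nat) :
  0 < d < 1 -> 0 < t < v -> v < 1 -> d * (1 - t) + t < v -> 0 < delta ->
  0 < c1 -> 0 < c2 ->
  exists N0 : nat, forall N H m : nat, (N0 <= N)%N ->
    c1 * N%:R `^ v <= H%:R <= c2 * N%:R `^ v ->
    (0 < m)%N -> m%:R <= 6 * N%:R `^ d ->
    [/\ (K0 <= N %/ m)%N,
        (N %/ m)%:R `^ t <= (H %/ m)%:R <= (N %/ m)%:R `^ (v + delta) &
        (4 * (H %/ m) <= N %/ m)%N].
Proof.
move=> /andP[d0 d1] /andP[t0 tv] v1 dtv de0 c10 c20.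
have [K1 HK1] := @eventually_powR_le R (2 * c2) v (v + delta) ltac:(lra).
have [K2 HK2] := @eventually_powR_le R (8 * c2) v 1 v1.
pose K := maxn K0 (maxn 1 (maxn K1 K2)).
have [N1 HN1] := @eventually_powR_le R (6 * K%:R) d 1 d1.
have [N2 HN2] := @eventually_powR_le R (12 / c1) (d * (1 - t) + t) v dtv.
exists (maxn N1 N2) => N H m; rewrite geq_max => /andP[/HN1[N0 {}HN1] /HN2[_ {}HN2]].
move=> /andP[H1 H2] m0 m6.
have mr0 : 0 < m%:R :> R by rewrite ltr0n.
have m1 : 1 <= m%:R :> R by rewrite ler1n.
have nr0 : 0 < N%:R :> R by rewrite ltr0n.
have KNm : (K <= N %/ m)%N.
  rewrite leq_divRL // -(ler_nat R) natrM.
  apply: le_trans (_ : 6 * K%:R * N%:R `^ d <= _); last by rewrite -[leRHS]powRr1.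
  have -> : 6 * K%:R * N%:R `^ d = K%:R * (6 * N%:R `^ d) by ring.
  exact: ler_wpM2l.
move: (KNm); rewrite !geq_max => /andP[K0n /andP[n1 /andP[/HK1[_ {}HK1] /HK2[_ {}HK2]]]].
set n := (N %/ m)%N in KNm K0n n1 HK1 HK2 *; set h := (H %/ m)%N.
have hH : h%:R * m%:R <= H%:R :> R by rewrite -natrM ler_nat leq_trunc_div.
have Hh : H%:R <= (h%:R + 1) * m%:R :> R.
  by rewrite natr1 -natrM ler_nat ltnW // ltn_ceil.
have nN : n%:R * m%:R <= N%:R :> R by rewrite -natrM ler_nat leq_trunc_div.
have Nn : N%:R <= 2 * (m%:R * n%:R) :> R.
  rewrite -!natrM ler_nat ltnW //; apply: leq_trans (ltn_ceil N m0) _.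
  rewrite -/n mulnC mulnCA leq_mul2l; apply/orP; right.
  by rewrite mul2n -addnn -[n.+1]addn1 leq_add2l.
pose w : R := (N%:R / m%:R) `^ t.
have nw : n%:R `^ t <= w.
  by rewrite ge0_ler_powR ?nnegrE ?divr_ge0 ?(ltW t0) ?(ltW mr0) // ler_pdivlMr.
have w1 : 1 <= w.
  apply: le_trans nw; rewrite powR_ge1 ?ler1n //; lra.
(* The factor 2 pays for the floor: [2 * w <= h + 1] together with [1 <= w] gives [w <= h]. *)
have wm : 2 * w * m%:R <= H%:R.
  have wm6 : w * m%:R <= 6 * N%:R `^ (d * (1 - t) + t).
    have -> : w * m%:R = m%:R `^ (1 - t) * N%:R `^ t.
      rewrite /w powRM ?invr_ge0 ?(ltW mr0) // -powR_inv1 ?(ltW mr0) // -powRrM mulN1r.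
      rewrite powR_natD // powRr1 ?(ltW mr0) //; ring.
    rewrite [N%:R `^ (_ + t)]powR_natD // mulrA ler_wpM2r ?powR_ge0 //.
    apply: (@le_trans _ _ ((6 * N%:R `^ d) `^ (1 - t))).
      by rewrite ge0_ler_powR ?nnegrE ?mulr_ge0 ?powR_ge0 ?(ltW mr0) //; lra.
    rewrite powRM ?powR_ge0 // -powRrM ler_wpM2r ?powR_ge0 //.
    by rewrite ler1_powR ?ler1n //; lra.
  apply: le_trans H1; rewrite -ler_pdivrMl //; apply: le_trans HN2.
  have -> : 12 / c1 * N%:R `^ (d * (1 - t) + t) =
    c1^-1 * (2 * (6 * N%:R `^ (d * (1 - t) + t))) by ring.
  by rewrite ler_wpM2l ?invr_ge0 ?(ltW c10) // -mulrA ler_wpM2l.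
have hu : h%:R <= 2 * c2 * n%:R `^ v :> R.
  rewrite -(ler_pM2r mr0); apply: le_trans hH _; apply: le_trans H2 _.
  have -> : 2 * c2 * n%:R `^ v * m%:R = c2 * (2 * (m%:R * n%:R `^ v)) by ring.
  rewrite ler_wpM2l ?(ltW c20) //.
  apply: (@le_trans _ _ ((2 * (m%:R * n%:R)) `^ v)).
    by rewrite ge0_ler_powR ?nnegrE ?mulr_ge0 //; lra.
  rewrite !powRM ?mulr_ge0 // ler_pM ?mulr_ge0 ?powR_ge0 //.
    by rewrite ler1_powR ?ler1n // ltW.
  by rewrite ler_wpM2r ?powR_ge0 // ler1_powR // ltW.
split=> //.
- apply/andP; split; last exact: le_trans hu HK1.
  apply: le_trans nw _; have : 2 * w <= h%:R + 1.
    by rewrite -(ler_pM2r mr0); exact: le_trans wm Hh.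
  lra.
- rewrite -(ler_nat R) natrM; move: HK2; rewrite powRr1 //; lra.
Qed.

(** [Q] is the integer part of [N ^ (1 - d)] and [M] that of [3 * N / Q], where [3 * N] bounds
    [x + H]. Truncation loses at most a factor 2 in [Q], hence the constant 6. *)
Lemma split_parameters (R : realType) (d : R) : 0 < d < 1 ->
  exists N0 : nat, forall N : nat, (N0 <= N)%N -> exists Q M : nat,
  [/\ (0 < Q <= N)%N, (M <= N)%N, (3 * N < Q.+1 * M.+1)%N,
      Q%:R <= N%:R `^ (1 - d) & M%:R <= 6 * N%:R `^ d].
Proof.
move=> /andP[d0 d1]; have [N1 HN1] := @eventually_powR_le R 6 d 1 d1.
exists (maxn 1 N1) => N; rewrite geq_max => /andP[N0 /HN1[_ {}HN1]].
have nr1 : 1 <= N%:R :> R by rewrite ler1n.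
pose T : R := N%:R `^ (1 - d); have T1 : 1 <= T by rewrite powR_ge1 //; lra.
pose Q := Num.truncn T; pose M := (3 * N %/ Q)%N.
have Q0 : (0 < Q)%N by rewrite truncn_gt0.
have QT : Q%:R <= T by rewrite truncn_le; lra.
have TQ : T / 2 <= Q%:R by exact: truncn_ge_half.
have Qr0 : 0 < Q%:R :> R by rewrite ltr0n.
have M6 : M%:R <= 6 * N%:R `^ d.
  apply: (@le_trans _ _ (3 * N%:R / Q%:R)).
    by rewrite ler_pdivlMr // -!natrM ler_nat leq_trunc_div.
  rewrite ler_pdivrMr //; apply: (@le_trans _ _ (6 * N%:R `^ d * (T / 2))).
    have -> : 6 * N%:R `^ d * (T / 2) = 3 * (N%:R `^ d * T) by field.
    by rewrite /T -powR_natD // addrC subrK powRr1.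
  by rewrite ler_wpM2l // mulr_ge0 // powR_ge0.
exists Q, M; split=> //.
- rewrite Q0 -(ler_nat R); apply: le_trans QT _.
  by rewrite -[leRHS]powRr1 // ler_powR //; lra.
- by rewrite -(ler_nat R); apply: le_trans M6 _; move: HN1; rewrite powRr1.
- apply: leq_trans (ltn_ceil (3 * N) Q0) _; rewrite mulnC leq_mul2r leqnSn orbT //.
Qed.

Lemma conv_integral_le (R : realType) (g : nat -> R) (v d t G e delta c1 c2 Ce b : R)
    (Ne : nat) :
  essentially_bounded g -> 0 < G < 1 -> 0 < d < 1 -> 0 < e ->
  0 < t < v -> v < 1 -> d * (1 - t) + t < v -> 0 < delta -> 0 < c1 -> 0 < c2 ->
  0 < Ce ->
  (forall N h, (Ne <= N)%N -> N%:R `^ t <= h%:R <= N%:R `^ (v + delta) ->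
     (4 * h <= N)%N ->
     second_diff_energy g N h <= Ce * N%:R `^ (1 + e) * h%:R `^ (2 - G)) ->
  1 + v + 7 * e <= b -> 2 - 2 * d + v + 7 * e <= b ->
  1 + v * (2 - G) + d * G + 7 * e <= b -> 1 + 2 * d + 7 * e <= b ->
  3 * v + 7 * e <= b ->
  exists (C : R) (N0 : nat), 0 < C /\ forall N H, (N0 <= N)%N -> (0 < H)%N ->
    c1 * N%:R `^ v <= H%:R <= c2 * N%:R `^ v ->
    symmetry_integral (dirichlet_conv g (fun=> 1)) N H <= C * N%:R `^ b.
Proof.
move=> gb /andP[G0 G1] d01 e0 tv v1 dtv de0 c10 c20 Ce0 HE b1 b2 b3 b4 b5.
have /andP[d0 d1] := d01; have /andP[t0 tv'] := tv.
have v0 : 0 < v by lra.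
have [Cg [Cg0 HCg]] := @essentially_bounded_le R g e gb e0.
have [Ch [Ch0 HCh]] := @harm_le_powR R e e0.
have [N1 HN1] := @split_parameters R d d01.
have [N2 HN2] := @dilated_scale R v t d delta c1 c2 Ne d01 tv v1 dtv de0 c10 c20.
have [N3 HN3] := @eventually_powR_le R c2 v 1 v1.
(* Then [k.+1 * e >= 2], so [k.+1] contractions by [N ^ (- e)] outweigh the factor [Q ^ 2 <= N ^ 2]
   in the large sieve error. *)
pose k := Num.truncn (2 / e).
(* [Kb] is the constant in the bound for [g] up to [3 * N]. [A1] belongs to the large sieve, and
   [A2], [A3], [A4] to the energies, to N M^2 and to H^3. *)
pose Kb := Cg * 3 `^ e.
pose A1 := 2 * (2 ^+ k.+1 * Kb ^+ 2 * (2 * c2 * Ch ^+ 3 + 2)).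
pose A2 := 12 * Ce * c2 `^ (2 - G) * Ch ^+ 2.
pose A3 := 48 * 36 * Kb ^+ 2 * Ch.
pose A4 := 16 * Kb ^+ 2 * c2 ^+ 3 * Ch ^+ 2.
have Kb0 : 0 < Kb by rewrite mulr_gt0 // powR_gt0.
have A10 : 0 < A1.
  by rewrite !mulr_gt0 ?exprn_gt0 // addr_gt0 // !mulr_gt0 ?exprn_gt0.
have A20 : 0 < A2 by rewrite !mulr_gt0 ?exprn_gt0 ?powR_gt0.
have A30 : 0 < A3 by rewrite !mulr_gt0 ?exprn_gt0.
have A40 : 0 < A4 by rewrite !mulr_gt0 ?exprn_gt0.
exists (3 * A1 + 2 * (A2 + A3 + A4)), (maxn N1 (maxn N2 N3)); split.
  by apply: addr_gt0; apply: mulr_gt0 => //; rewrite !addr_gt0.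
move=> N H; rewrite !geq_max => /andP[/HN1[Q [M [/andP[Q0 QN] MN QM QT MT]]]].
move=> /andP[NN2 /HN3[N0 {}HN3]] H0 cH; have /andP[cH1 cH2] := cH.
set n : R := N%:R in QT MT HN3 cH cH1 cH2 *.
have n1 : 1 <= n by rewrite ler1n.
have n0 : 0 < n by lra.
have nn0 := ltW n0.
have pw a a' : a <= a' -> n `^ a <= n `^ a' by exact: ler_powR.
have pD a a' : n `^ a * n `^ a' = n `^ (a + a') by rewrite powR_natD.
have p0 a : 0 <= n `^ a by exact: powR_ge0.
have pX a (j : nat) : n `^ a ^+ j = n `^ (a * j%:R) by rewrite powRrM powR_mulrn.
have HN : (H <= N)%N.
  by rewrite -(ler_nat R); apply: le_trans cH2 _; move: HN3; rewrite powRr1.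
(* [R'] is the margin of order N^e by which [Z] exceeds [Q ^ 2]; it makes each averaging contract by
   [N ^ (- e)]. *)
pose R' := (Num.truncn (n `^ e)).+1.
have eR' : n `^ e <= R'%:R by rewrite ltW // truncnS_gt.
have R'e : R'%:R <= 2 * n `^ e.
  have : 1 <= n `^ e by rewrite powR_ge1 // ltW.
  have : (Num.truncn (n `^ e))%:R <= n `^ e by rewrite truncn_le p0.
  rewrite /R' -natr1; lra.
pose Z := (N + Q ^ 2 * R')%N.
pose B := Cg * (3 * N)%:R `^ e.
have BE : B = Kb * n `^ e by rewrite /B natrM powRM // mulrA.
have B0 : 0 <= B by rewrite BE mulr_ge0 // ltW.
have B2 : B ^+ 2 = Kb ^+ 2 * n `^ (2 * e) by rewrite BE exprMn pX mulrC [_ * 2]mulrC mulrC.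
have B20 : 0 <= B ^+ 2 by exact: sqr_ge0.
have Ce0' := ltW Ce0; have Ch0' := ltW Ch0; have Kb0' := ltW Kb0; have c20' := ltW c20.
have hQ : harm R Q <= Ch * n `^ e by exact: HCh.
have hM : harm R M <= Ch * n `^ e by exact: HCh.
have hQ0 := harm_ge0 R Q; have hM0 := harm_ge0 R M.
have Hr0 : 0 <= H%:R :> R by [].
apply: le_trans (@symmetry_integral_conv_le R g B Q M N H Z k N0 HN B0 (HCg _) QN MN QM _) _.
  exact: leq_addr.
have Qr0 : 0 < Q%:R :> R by rewrite ltr0n.
have Q2 : Q%:R ^+ 2 <= n `^ (2 - 2 * d).
  have -> : 2 - 2 * d = (1 - d) * 2%:R by ring.
  by rewrite -pX lerXn2r ?nnegrE.
have ZE : Z%:R = n + Q%:R ^+ 2 * R'%:R :> R by rewrite /Z natrD natrM natrX.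
have Zle : Z%:R <= n + 2 * n `^ (2 - 2 * d + e).
  rewrite ZE lerD2l -pD mulrCA ler_pM //; exact: sqr_ge0.
have Z0 : 0 < Z%:R :> R by rewrite ZE ltr_pwDl // mulr_ge0 ?sqr_ge0.
have tail : 2 * Q%:R ^+ 2 * (Q%:R ^+ 2 / (2 * Z)%:R) ^+ k.+1 <= 2 :> R.
  have q : Q%:R ^+ 2 / (2 * Z)%:R <= n `^ (- e).
    rewrite ler_pdivrMr ?natrM ?mulr_gt0 //.
    apply: (@le_trans _ _ (n `^ (- e) * (Q%:R ^+ 2 * R'%:R))).
      rewrite mulrCA ler_peMr ?sqr_ge0 //.
      apply: (@le_trans _ _ (n `^ (- e) * n `^ e)); last by rewrite ler_wpM2l.
      by rewrite pD addNr powRr0.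
    rewrite ler_wpM2l // ZE.
    have : 0 <= Q%:R ^+ 2 * R'%:R :> R by rewrite mulr_ge0 ?sqr_ge0.
    lra.
  have qk : (Q%:R ^+ 2 / (2 * Z)%:R) ^+ k.+1 <= n `^ (- 2).
    apply: (@le_trans _ _ (n `^ (- e) ^+ k.+1)).
      by rewrite lerXn2r ?nnegrE ?divr_ge0 ?sqr_ge0.
    rewrite pX pw // mulNr lerN2 mulrC -ler_pdivrMr // ltW //.
    exact: truncnS_gt.
  rewrite -mulrA ler_piMr //.
  apply: (@le_trans _ _ (n `^ 2 * n `^ (- 2))); last by rewrite pD subrr powRr0.
  rewrite ler_pM ?sqr_ge0 ?exprn_ge0 ?divr_ge0 ?sqr_ge0 //.
  by apply: le_trans Q2 _; apply: pw; lra.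
have I1 : 2 * H%:R * harm R Q ^+ 3 +
    2 * Q%:R ^+ 2 * (Q%:R ^+ 2 / (2 * Z)%:R) ^+ k.+1 <=
    (2 * c2 * Ch ^+ 3 + 2) * n `^ (v + 3 * e).
  rewrite [leRHS]mulrDl lerD //; last first.
    by apply: le_trans tail _; rewrite ler_peMr // powR_ge1 //; lra.
  have -> : 2 * c2 * Ch ^+ 3 * n `^ (v + 3 * e) =
      (2 * (c2 * n `^ v)) * (Ch * n `^ e) ^+ 3.
    by rewrite exprMn pX -pD [3 * e]mulrC; ring.
  rewrite ler_pM ?mulr_ge0 ?exprn_ge0 // ?ler_wpM2l //.
  by rewrite lerXn2r ?nnegrE // (le_trans hQ0).
have partI : 2 * (2 ^+ k.+1 * Z%:R * (B ^+ 2 * (2 * H%:R * harm R Q ^+ 3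
     + 2 * Q%:R ^+ 2 * (Q%:R ^+ 2 / (2 * Z)%:R) ^+ k.+1))) <= 3 * A1 * n `^ b.
  apply: (@le_trans _ _ (2 * (2 ^+ k.+1 * (n + 2 * n `^ (2 - 2 * d + e)) *
     (B ^+ 2 * ((2 * c2 * Ch ^+ 3 + 2) * n `^ (v + 3 * e)))))).
    apply: ler_wpM2l => //; apply: ler_pM.
    - by rewrite mulr_ge0 ?exprn_ge0.
    - apply: mulr_ge0 => //; apply: addr_ge0; first by rewrite !mulr_ge0 ?exprn_ge0.
      apply: mulr_ge0; first by rewrite mulr_ge0 ?exprn_ge0.
      by rewrite exprn_ge0 // divr_ge0 ?sqr_ge0.
    - by rewrite ler_wpM2l ?exprn_ge0.
    - exact: ler_wpM2l.
  rewrite B2.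
  have -> : 2 * (2 ^+ k.+1 * (n + 2 * n `^ (2 - 2 * d + e)) *
     (Kb ^+ 2 * n `^ (2 * e) * ((2 * c2 * Ch ^+ 3 + 2) * n `^ (v + 3 * e)))) =
     A1 * (n `^ 1 * n `^ (2 * e) * n `^ (v + 3 * e)
       + 2 * (n `^ (2 - 2 * d + e) * n `^ (2 * e) * n `^ (v + 3 * e))).
    by rewrite powRr1 // /A1; ring.
  rewrite !pD.
  have h1 : n `^ (1 + 2 * e + (v + 3 * e)) <= n `^ b by apply: pw; lra.
  (* This is the largest loss: one [e] from [Z], two from [B ^ 2] and three from the harmonic
     sums. *)
  have h2 : n `^ (2 - 2 * d + e + 2 * e + (v + 3 * e)) <= n `^ b by apply: pw; lra.
  have -> : 3 * A1 * n `^ b = A1 * (3 * n `^ b) by ring.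
  apply: ler_wpM2l; [exact: ltW|lra].
have energy : \sum_(m < M) 2 * m.+1%:R ^+ 2 *
    second_diff_energy g (N %/ m.+1) (H %/ m.+1) <=
    12 * Ce * c2 `^ (2 - G) * n `^ (1 + e + v * (2 - G) + d * G) * harm R M.
  rewrite /harm mulr_sumr; apply: ler_sum => m _.
  have mM : m.+1%:R <= M%:R :> R by rewrite ler_nat ltn_ord.
  have [c_1 c_2 c_3] := HN2 N H m.+1 NN2 cH isT (le_trans mM MT).
  apply: (@le_trans _ _ (2 * Ce * (m.+1%:R ^+ 2 *
     ((N %/ m.+1)%:R `^ (1 + e) * (H %/ m.+1)%:R `^ (2 - G))))).
    have -> : 2 * Ce * (m.+1%:R ^+ 2 *
     ((N %/ m.+1)%:R `^ (1 + e) * (H %/ m.+1)%:R `^ (2 - G))) =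
     2 * m.+1%:R ^+ 2 * (Ce * (N %/ m.+1)%:R `^ (1 + e) * (H %/ m.+1)%:R `^ (2 - G)).
      ring.
    by rewrite ler_wpM2l ?mulr_ge0 ?sqr_ge0 //; exact: HE.
  apply: (@le_trans _ _ (2 * Ce * (N%:R `^ (1 + e) * H%:R `^ (2 - G) *
      m.+1%:R `^ G * m.+1%:R^-1))).
    rewrite ler_wpM2l ?mulr_ge0 ?(ltW Ce0) //; apply: dilated_le => //.
      exact: ltW.
    by rewrite G0.
  have HG : H%:R `^ (2 - G) <= c2 `^ (2 - G) * n `^ (v * (2 - G)).
    rewrite powRrM -powRM ?(ltW c20) // ge0_ler_powR ?nnegrE ?mulr_ge0 ?(ltW c20) //.
    lra.
  have mG : m.+1%:R `^ G <= 6 * n `^ (d * G).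
    apply: (@le_trans _ _ ((6 * n `^ d) `^ G)).
      rewrite ge0_ler_powR ?nnegrE ?mulr_ge0 ?(ltW G0) //.
      exact: le_trans mM MT.
    rewrite powRM // -powRrM ler_wpM2r // ler1_powR ?ler1n // ltW //.
  rewrite mulrA ler_wpM2r ?invr_ge0 //.
  have -> : 12 * Ce * c2 `^ (2 - G) * n `^ (1 + e + v * (2 - G) + d * G) =
    2 * Ce * (n `^ (1 + e) * (c2 `^ (2 - G) * n `^ (v * (2 - G))) * (6 * n `^ (d * G))).
    by rewrite -!pD; ring.
  rewrite ler_wpM2l ?mulr_ge0 ?(ltW Ce0) // ler_pM ?mulr_ge0 ?powR_ge0 //.
  by rewrite ler_wpM2l.
have M2 : M%:R ^+ 2 <= 36 * n `^ (2 * d).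
  have -> : 36 * n `^ (2 * d) = (6 * n `^ d) ^+ 2 by rewrite exprMn pX [d * _]mulrC; ring.
  by rewrite lerXn2r ?nnegrE ?mulr_ge0.
have H3 : H%:R ^+ 3 <= c2 ^+ 3 * n `^ (3 * v).
  have -> : n `^ (3 * v) = (n `^ v) ^+ 3 by rewrite pX mulrC.
  by rewrite -exprMn lerXn2r ?nnegrE ?mulr_ge0 ?(ltW c20).
have partII : harm R M * (\sum_(m < M) 2 * m.+1%:R ^+ 2 *
     second_diff_energy g (N %/ m.+1) (H %/ m.+1)
   + 48 * B ^+ 2 * N%:R * M%:R ^+ 2 + 16 * B ^+ 2 * H%:R ^+ 3 * harm R M) <=
   (A2 + A3 + A4) * n `^ b.
  apply: (@le_trans _ _ ((Ch * n `^ e) * (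
    12 * Ce * c2 `^ (2 - G) * n `^ (1 + e + v * (2 - G) + d * G) * (Ch * n `^ e)
    + 48 * B ^+ 2 * n * (36 * n `^ (2 * d))
    + 16 * B ^+ 2 * (c2 ^+ 3 * n `^ (3 * v)) * (Ch * n `^ e)))).
    have S0 : 0 <= \sum_(m < M) 2 * m.+1%:R ^+ 2 *
        second_diff_energy g (N %/ m.+1) (H %/ m.+1).
      apply: sumr_ge0 => m _; rewrite mulr_ge0 ?mulr_ge0 ?sqr_ge0 //.
      exact: second_diff_energy_ge0.
    have b48 : 0 <= 48 * B ^+ 2 by exact: mulr_ge0.
    have b16 : 0 <= 16 * B ^+ 2 by exact: mulr_ge0.
    apply: ler_pM => //.
      apply: addr_ge0; first apply: addr_ge0 => //.
        by apply: mulr_ge0; [exact: mulr_ge0|exact: sqr_ge0].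
      by apply: mulr_ge0 => //; apply: mulr_ge0 => //; exact: exprn_ge0.
    apply: lerD; [apply: lerD|].
    - by apply: le_trans energy _; rewrite ler_wpM2l // !mulr_ge0 ?powR_ge0.
    - by apply: ler_wpM2l => //; exact: mulr_ge0.
    - apply: ler_pM => //; last exact: ler_wpM2l.
      by apply: mulr_ge0 => //; exact: exprn_ge0.
  rewrite B2.
  have -> : (Ch * n `^ e) * (
    12 * Ce * c2 `^ (2 - G) * n `^ (1 + e + v * (2 - G) + d * G) * (Ch * n `^ e)
    + 48 * (Kb ^+ 2 * n `^ (2 * e)) * n * (36 * n `^ (2 * d))
    + 16 * (Kb ^+ 2 * n `^ (2 * e)) * (c2 ^+ 3 * n `^ (3 * v)) * (Ch * n `^ e)) =
    A2 * (n `^ e * n `^ (1 + e + v * (2 - G) + d * G) * n `^ e)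
    + A3 * (n `^ e * n `^ (2 * e) * n `^ 1 * n `^ (2 * d))
    + A4 * (n `^ e * n `^ (2 * e) * n `^ (3 * v) * n `^ e).
    by rewrite powRr1 // /A2 /A3 /A4; ring.
  rewrite !pD.
  have g2 : n `^ (e + (1 + e + v * (2 - G) + d * G) + e) <= n `^ b by apply: pw; lra.
  have g3 : n `^ (e + 2 * e + 1 + 2 * d) <= n `^ b by apply: pw; lra.
  have g4 : n `^ (e + 2 * e + 3 * v + e) <= n `^ b by apply: pw; lra.
  have {}g2 := ler_wpM2l (ltW A20) g2; have {}g3 := ler_wpM2l (ltW A30) g3.
  have {}g4 := ler_wpM2l (ltW A40) g4.
  by rewrite [leRHS]mulrDl [X in _ <= X + _]mulrDl (lerD (lerD g2 g3) g4).
rewrite [leRHS]mulrDl -[2 * (A2 + A3 + A4) * _]mulrA.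
by apply: lerD; [exact: partI|exact: ler_wpM2l].
Qed.

Theorem theorem1 (R : realType) (g : nat -> R) (H : nat -> nat)
    (vartheta G : R)
    (g_bounded : essentially_bounded g)
    (vartheta_range : 3^-1 < vartheta < 1)
    (H_pos : forall N : nat, (0 < N)%N -> (0 < H N)%N)
    (H_order : (fun N : nat => (H N)%:R : R) =Theta_\oo
               (fun N : nat => N%:R `^ vartheta : R))
    (G_range : 0 < G < 1)
    (g_symmetry : forall (theta : R) (h : nat -> nat),
        (3 * vartheta - 1) / ((1 - G) * vartheta + G + 1) < theta <= vartheta ->
        (fun N : nat => (h N)%:R : R) =Theta_\oo
          (fun N : nat => N%:R `^ theta : R) ->
        (fun N : nat => symmetry_integral g N (h N)) =O_\oo
          (fun N : nat => N%:R * (h N)%:R `^ (2 - G) : R)) :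
  forall G' : R,
    0 < G' < Num.min ((3 - vartheta^-1) / (1 + 2 * G^-1)) (vartheta^-1 - 1) ->
    (fun N : nat => symmetry_integral (dirichlet_conv g (fun=> 1)) N (H N)) =O_\oo
      (fun N : nat => N%:R * (H N)%:R `^ (2 - G') : R).
Proof.
move=> G' G'range.
have [d [t [e [[d01 e0 tv] t0t dtv [b1 b2 b3 b4 b5]]]]] :=
  exponent_choice vartheta_range G_range G'range.
have /andP[v3 v1] := vartheta_range; have /andP[_ tv'] := tv.
have v0 : 0 < vartheta by apply: lt_trans v3; rewrite invr_gt0.
have G'2 : 0 <= 2 - G'.
  have : 0 <= vartheta * (2 - G') by have /andP[d0 _] := d01; lra.
  by rewrite pmulr_rge0.
(* The hypothesis holds on an interval open at its lower end; starting strictly inside at [t] gives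
   a closed interval, which finitely many scales can cover. *)
have sb theta : t <= theta <= vartheta -> scale_bound g G theta.
  move=> /andP[tt tv2] h; apply: g_symmetry.
  by rewrite tv2 andbT; exact: lt_le_trans t0t tt.
have [delta [Ce [Ne [de0 Ce0 HE]]]] :=
  second_diff_energy_range g_bounded G_range tv (ltW v1) e0 sb.
have /bigTheta_natP[c1 [c2 [N1 [c10 c20 HH]]]] := H_order.
have [C [N2 [C0 HC]]] := conv_integral_le g_bounded G_range d01 e0 tv v1 dtv
  de0 c10 c20 Ce0 HE b1 b2 b3 b4 b5.
(* Dividing by [c1 ^ (2 - G')] turns [N ^ (vartheta * (2 - G'))] into a bound by [H ^ (2 - G')],
   through [c1 * N ^ vartheta <= H] and [0 <= 2 - G']. *)
apply/bigO_natP; exists (C / c1 `^ (2 - G')), (maxn 1 (maxn N1 N2)).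
have c0 : 0 < c1 `^ (2 - G') by rewrite powR_gt0.
split=> [|N]; first by rewrite divr_gt0.
rewrite !geq_max => /andP[N0 /andP[NN1 NN2]].
have := HH N NN1; rewrite normr_nat (ger0_norm (powR_ge0 _ _)) => HN.
have J0 : 0 <= symmetry_integral (dirichlet_conv g (fun=> 1)) N (H N).
  by rewrite sumr_ge0 // => x _; rewrite exprn_ge0.
rewrite ger0_norm // ger0_norm ?mulr_ge0 ?powR_ge0 //.
apply: le_trans (HC N (H N) NN2 (H_pos N N0) HN) _.
rewrite -mulrA ler_wpM2l ?(ltW C0) // ler_pdivlMl //.
rewrite powR_natD // powRr1 // mulrCA ler_wpM2l //.
rewrite powRrM -powRM ?powR_ge0 ?(ltW c10) //.
have /andP[HN1 _] := HN.
by rewrite ge0_ler_powR ?nnegrE ?mulr_ge0 ?powR_ge0 ?(ltW c10).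
Qed.
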